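(* Let $L$ be any subdivision of the triangle ($2$-simplex), with no new vertices added to the boundary. Then the generalized Tchebyshev polynomials of the first kind $T^L_n(x)$, $n\ge 0$, have only real roots.
   Context: Simplicial complexes are finite abstract simplicial complexes, containing the empty face. The link of a face $\sigma$ of $K$ is $\mathrm{link}_K(\sigma)=\{\tau\in K: \sigma\cap\tau=\emptyset,\ \sigma\cup\tau\in K\}$. $f_i(K)$ is the number of $i$-dimensional faces of $K$. The $F$-polynomial of $K$ is $F(K,x)=\sum_{j=0}^{\dim K+1} f_{j-1}(K)\left(\frac{x-1}{2}\right)^j$. $L$ is a triangulation of the $2$-simplex such that the only vertices of $L$ on the boundary are the three original vertices; $\partial(L)$ denotes the subcomplex of boundary faces of $L$, which is the boundary complex of the original $2$-simplex, and $V(\partial(L))$ is the set of the three original vertices. A simplicial complex $K'$ is a generalized Tchebyshev triangulation of $K$ induced by $L$ if there is an ordered list $\sigma_1,\ldots,\sigma_m$ of the $2$-dimensional faces of $K$, listing each exactly once, bijections $\phi_{\sigma_i}:V(\partial(L))\to\sigma_i$, and simplicial complexes $K_0=K,K_1,\ldots,K_m=K'$ such that for each $i\geq 1$ the complex $K_i$ is obtained from $K_{i-1}$ as follows: take an isomorphic copy $L_i$ of $L$ in which each boundary vertex $w\in V(\partial(L))$ is identified with $\phi_{\sigma_i}(w)$ and the interior vertices are new vertices, and replace the family of faces $\{\sigma_i\cup\tau:\tau\in\mathrm{link}_{K_{i-1}}(\sigma_i)\}$ by the family $\{\sigma'\cup\tau:\sigma'\in L_i,\ \tau\in\mathrm{link}_{K_{i-1}}(\sigma_i)\}$.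 All generalized Tchebyshev triangulations of a given $K$ induced by $L$ have the same $f$-vector, hence the same $F$-polynomial, and there is a unique linear map $T^L:\mathbb{R}[x]\to\mathbb{R}[x]$ with $T^L(F(K,x))=F(K',x)$ for every simplicial complex $K$ and every generalized Tchebyshev triangulation $K'$ of $K$ induced by $L$. One defines $T^L_n(x):=T^L(x^n)$. *)

(* Defs.v *)
From HB Require Import structures.
From mathcomp Require Import all_boot all_order all_algebra.
From mathcomp Require Import classical_sets reals complex.

Set Implicit Arguments.
Unset Strict Implicit.
Unset Printing Implicit Defensive.

Import GRing.Theory Num.Theory.
Local Open Scope ring_scope.

(* A complex is a set of finite subsets of an ambient finite type V; not every
   point of V has to be a vertex, so V can also hold the new vertices created
   by a subdivision. *)
Section Complexes.
Variable V : finType.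
Implicit Types (K : {set {set V}}) (s t : {set V}).

Definition simplicial_complex K : Prop :=
  finset.set0 \in K /\ forall s t, s \in K -> t \subset s -> t \in K.

Definition vertices K : {set V} := [set v | [set v]%SET \in K]%SET.

Definition link K s : {set {set V}} :=
  [set t in K | [disjoint s & t] && (s :|: t \in K)]%SET.

(* nfaces K j is f_{j-1}(K): faces of dimension j - 1 have j vertices. *)
Definition nfaces K (j : nat) : nat := #|[set s in K | #|s| == j]%SET|.

(* dim K + 1 *)
Definition rank K : nat := \max_(s in K) #|s|.

Definition Fpoly (R : realType) K : {poly R} :=
  \sum_(j < (rank K).+1) (nfaces K j)%:R *: ((2^-1)%:P * ('X - 1)) ^+ j.

End Complexes.

Section Geometry.
Variables (R : realType) (W : finType) (p : W -> 'rV[R]_2).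
Implicit Types (L : {set {set W}}) (A B : {set W}).

Definition hull A : set 'rV[R]_2 :=
  [set x | exists a : W -> R,
     [/\ forall w, w \in A -> 0 <= a w,
         \sum_(w in A) a w = 1
       & x = \sum_(w in A) a w *: p w]]%classic.

Definition affinely_independent A : Prop :=
  forall a : W -> R, \sum_(w in A) a w = 0 ->
    \sum_(w in A) a w *: p w = 0 -> forall w, w \in A -> a w = 0.

(* p realizes L as a geometric simplicial complex whose underlying space is
   the triangle with corners p @ B, and L has no vertex on the boundary of
   this triangle besides its corners. *)
Definition geometric_triangulation L B : Prop :=
  [/\ [/\ #|B| = 3%N, B \subset vertices L & affinely_independent B],
      forall s, s \in L -> affinely_independent s,
      forall s t, s \in L -> t \in L ->
        (hull s `&` hull t = hull (s :&: t)%SET)%classic,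
      (\bigcup_(s in [set` L]) hull s = hull B)%classic
    & forall w A, w \in vertices L -> A \proper B -> hull A (p w) -> w \in B].

End Geometry.

(* B is the set of the three original vertices. *)
Definition triangle_triangulation (R : realType) (W : finType)
    (L : {set {set W}}) (B : {set W}) : Prop :=
  simplicial_complex L /\
  exists p : W -> 'rV[R]_2, geometric_triangulation p L B.

Section Tchebyshev.
Variables (W : finType) (L : {set {set W}}) (B : {set W}) (V : finType).
Implicit Types (K : {set {set V}}) (s : {set V}) (psi : W -> V).

Definition replace_face K s psi : {set {set V}} :=
  (K :\: [set s :|: t | t in link K s]
     :|: [set (psi @: s') :|: t
          | s' : {set W} in L, t : {set V} in link K s])%SET.

(* psi sends L to its isomorphic copy: its restriction to B is the bijection
   from B onto s, and the images of the interior vertices are new. *)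
Definition tchebyshev_step K s K' : Prop :=
  exists psi,
    [/\ {in vertices L &, injective psi},
        psi @: B = s,
        forall w, w \in vertices L -> w \notin B -> psi w \notin vertices K
      & K' = replace_face K s psi].

Definition gen_tchebyshev_triangulation K K' : Prop :=
  exists (sigma : seq {set V}) (Ks : nat -> {set {set V}}),
    [/\ uniq sigma,
        forall s, (s \in sigma) = (s \in K) && (#|s| == 3%N),
        Ks 0%N = K,
        Ks (size sigma) = K'
      & forall i, (i < size sigma)%N ->
          tchebyshev_step (Ks i) (nth finset.set0 sigma i) (Ks i.+1)].

End Tchebyshev.

(* The defining property of the linear map T^L. *)
Definition is_tchebyshev_map (R : realType) (W : finType)
    (L : {set {set W}}) (B : {set W})
    (T : {linear {poly R} -> {poly R}}) : Prop :=
  forall (V : finType) (K K' : {set {set V}}),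
    simplicial_complex K -> gen_tchebyshev_triangulation L B K K' ->
    T (Fpoly R K) = Fpoly R K'.

Definition only_real_roots (R : realType) (q : {poly R}) : Prop :=
  forall z : R[i], root (map_poly (real_complex R) q) z -> complex.Im z = 0.

(* Main.v *)
(* Put t = (x - 1) / 2.  If the triangle itself is a face of L then T is the
   identity.  Otherwise let L have m interior vertices and D edges joining a
   corner to an interior vertex.

   Plane geometry.  Fix a direction d parallel to no edge.  From every point c
   of the triangle, the points c + e d (and c - e d) for small e > 0 that stay in
   the triangle lie in exactly one 2-face.  Applied to midpoints of edges this
   gives the number of 2-faces containing an edge; applied to vertices it gives
   the number 2m + 1 of 2-faces, since a 2-face is entered along +-d from exactly
   one of its vertices, namely the one of middle height.  Hence the number of
   faces of L with j corners and k other vertices is m, D, 3, 3m - D, D - 3,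
   2m + 1 - D for (j, k) = (0,1), (1,1), (2,1), (0,2), (1,2), (0,3).

   Recurrence.  Subdividing one triangle of a simplex replaces it by a join of a
   copy of L, so T(t^n) satisfies a recurrence of order 3 with these counts as
   coefficients.  In terms of x^n it reads: in the functional y^n |-> T_n(x),
   v = y - x satisfies v^3 = D (x^2 - 1) v + 2 m x (x^2 - 1).

   Roots.  The recurrence is homogeneous in (x, sqrt(1 - x^2)), so it suffices
   that the polynomials A_n(w) obtained from v^3 = - D v - 2 m w do not vanish on
   the upper half plane.  Writing b, c for the values of the functional on
   y^n v / (- 2 m w) and y^n v^2 / (- 2 m w), the ratios a = A / (2 m w b) and
   e = c / b - a stay in the cone Im a > 0, Im e >= 0, Im (w a conj(e)) >= 0; this
   only uses 1 <= D <= 2 m + 1. *)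
Require Import Defs.
From mathcomp Require Import boolp classical_sets.
From mathcomp Require Import all_boot all_order all_algebra.
From mathcomp Require Import reals complex ring lra zify.
Set Implicit Arguments.
Unset Strict Implicit.
Unset Printing Implicit Defensive.
Import Order.TTheory GRing.Theory Num.Theory.
Local Open Scope ring_scope.

(** * Non-vanishing of the cubic recurrence on the upper half plane *)

Section HalfPlane.
Local Open Scope complex_scope.
Variable (R : rcfType).
Implicit Types w a e z : R[i].
Local Notation Re := (@complex.Re R).
Local Notation Im := (@complex.Im R).

(** Since [w * w^*] is the positive real [|w|^2], the sign of the imaginary part of a quotient can
    be read off without dividing. *)
Lemma Im_div z w : w != 0 ->
  Im (z / w) * (Re w ^+ 2 + Im w ^+ 2) = Im (z * w^*).
Proof.
move=> w0; have -> : z * w^* = (z / w) * (w * w^*) by rewrite mulrA divfK.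
case: (z / w) => a b; case: w {w0} => c d /=; ring.
Qed.

(** The last condition supplies the cross term left over when the first two are propagated along the
    recurrence. *)
Definition half_plane_cone w a e :=
  [/\ 0 < Im a, 0 <= Im e & 0 <= Im (w * a * e^*)].

(** The new pair is one step of the recurrence: if [A = 2 m w a b] and [c = (e + a) b], the next [b]
    is [(w + e + a) b]. Clearing [|w + e + a|^2] turns each condition into a sum of terms of known
    sign, with [D - 1], [2 m - 1] and [2 m + 1 - D] as the only coefficients depending on the
    parameters. *)
Lemma half_plane_cone_step (m D : R) w a e :
  1 <= D -> D <= 2 * m + 1 -> 1 <= 2 * m -> 0 < Im w ->
  half_plane_cone w a e ->
  half_plane_cone w ((w * a - 1) / (w + (e + a)))
    ((w * (e + a) - D%:C + (2 * m)%:C * w * a - (w * a - 1)) / (w + (e + a))).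
Proof.
move=> D1 Dm m1 w_gt0 [a_gt0 e_ge0 X_ge0].
have M_gt0 : 0 < Im (w + (e + a)).
  move: w_gt0 a_gt0 e_ge0; case: w {X_ge0} => ? ?.
  by case: a => ? ?; case: e => ? ? /=; lra.
have M_neq0 : w + (e + a) != 0.
  by apply/eqP => M0; move: M_gt0; rewrite M0 /= ltxx.
have n_gt0 : 0 < Re (w + (e + a)) ^+ 2 + Im (w + (e + a)) ^+ 2.
  by rewrite ltr_wpDl ?sqr_ge0 // exprn_gt0.
have sgn z : (0 < Im (z / (w + (e + a)))) = (0 < Im (z * (w + (e + a))^*)).
  by rewrite -Im_div // pmulr_lgt0.
have sgn0 z : (0 <= Im (z / (w + (e + a)))) = (0 <= Im (z * (w + (e + a))^*)).
  by rewrite -Im_div // pmulr_lge0.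
(* Both components have denominator [w + e + a], so the form in the third condition is merely
   divided by its squared modulus. *)
have sgn2 z1 z2 : 0 <= Im (w * z1 * z2^*) ->
    0 <= Im (w * (z1 / (w + (e + a))) * (z2 / (w + (e + a)))^*).
  suff -> : Im (w * z1 * z2^*) =
      Im (w * (z1 / (w + (e + a))) * (z2 / (w + (e + a)))^*) *
      (Re (w + (e + a)) ^+ 2 + Im (w + (e + a)) ^+ 2) by rewrite pmulr_lge0.
  have {1}-> : z1 = z1 / (w + (e + a)) * (w + (e + a)) by rewrite divfK.
  have {1}-> : z2 = z2 / (w + (e + a)) * (w + (e + a)) by rewrite divfK.
  case: (z1 / _) => ? ?; case: (z2 / _) => ? ?; case: (w + _) => ? ?.
  case: (w) => ? ? /=; ring.
split; rewrite ?sgn ?sgn0; last apply: sgn2.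
all: move: w_gt0 a_gt0 e_ge0 X_ge0; clear -D1 Dm m1.
all: case: w => x y; case: a => p q; case: e => r s /=.
all: set X := (X in _ -> _ -> _ -> 0 <= X -> _) => y0 q0 s0 X0.
- rewrite [ltRHS](_ : _ = (x ^+ 2 + y ^+ 2) * q + (X + (p ^+ 2 + q ^+ 2) * y)
      + y + (s + q)); last by rewrite /X; ring.
  have := sqr_ge0 x; have := sqr_ge0 y; have := sqr_ge0 p; have := sqr_ge0 q.
  nra.
- rewrite [leRHS](_ : _ = (x ^+ 2 + y ^+ 2) * (s + q)
      + ((r + p) ^+ 2 + (s + q) ^+ 2) * y + (D - 1) * (y + (s + q))
      + (2 * m - 1) * ((x ^+ 2 + y ^+ 2) * q + (X + (p ^+ 2 + q ^+ 2) * y)));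
    last by rewrite /X; ring.
  have h : 0 <= 2 * m - 1 by lra.
  have h' : 0 <= D - 1 by lra.
  have y1 := ltW y0; have q1 := ltW q0.
  by repeat first [done | exact: sqr_ge0 | apply: addr_ge0 | apply: mulr_ge0].
- rewrite [leRHS](_ : _ = (x ^+ 2 + y ^+ 2) * X
      + (x ^+ 2 + y ^+ 2) * (s + (2 * m + 1 - D) * q)
      + y * ((2 * m + 1 - D) * ((x * p - y * q) ^+ 2 + (x * q + y * p) ^+ 2)
             + (D - 1) * ((1 - (x * p - y * q)) ^+ 2 + (x * q + y * p) ^+ 2)));
    last by rewrite /X; ring.
  have h : 0 <= 2 * m + 1 - D by lra.
  have h' : 0 <= D - 1 by lra.
  have y1 := ltW y0; have q1 := ltW q0.
  by repeat first [done | exact: sqr_ge0 | apply: addr_ge0 | apply: mulr_ge0].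
Qed.

Lemma cubic_recurrence_nonzero (m D : R) w (A b c : nat -> R[i]) :
  1 <= D -> D <= 2 * m + 1 -> 1 <= 2 * m -> 0 < Im w ->
  A 0%N = 1 -> b 0%N = 0 -> c 0%N = 0 ->
  (forall n, A n.+1 = w * A n - (2 * m)%:C * w * b n) ->
  (forall n, b n.+1 = w * b n + c n) ->
  (forall n, c n.+1 = w * c n - D%:C * b n + A n) ->
  forall n, A n != 0.
Proof.
move=> D1 Dm m1 w_gt0 A0 b0 c0 AS bS cS.
have Im_neq0 z : 0 < Im z -> z != 0.
  by move=> z_gt0; apply/eqP => z0; move: z_gt0; rewrite z0 ltxx.
have w0 := Im_neq0 _ w_gt0.
have m0 : (2 * m)%:C != 0 :> R[i].
  by rewrite eq_complex /= eqxx andbT gt_eqF //; lra.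
(* As [b 0 = b 1 = 0] and [b 2 = 1], the ratios exist only from index 2 on; [A 0 = 1] and [A 1 = w]
   are treated directly. *)
suff step n : exists a e, [/\ half_plane_cone w a e, b n.+2 != 0,
    A n.+2 = (2 * m)%:C * w * a * b n.+2 & c n.+2 = (e + a) * b n.+2].
  case=> [|[|n]]; first by rewrite A0 oner_eq0.
    by rewrite AS A0 b0 mulr0 subr0 mulr1.
  have [a [e [[a_gt0 _ _] bn -> _]]] := step n.
  by rewrite !mulf_neq0 // Im_neq0.
elim: n => [|n [a [e [cone bn An cn]]]].
  (* These are the ratios given by [A 2 = w^2], [b 2 = 1] and [c 2 = 2 w]. *)
  exists (w * ((2 * m)^-1)%:C), (w * (2 - (2 * m)^-1)%:C).
  have mi : 0 < (2 * m)^-1 by rewrite invr_gt0; lra.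
  have mi1 : (2 * m)^-1 <= 1 by rewrite invf_le1; lra.
  rewrite !(AS, bS, cS) A0 b0 c0 !(mulr0, add0r, subr0, addr0, mulr1, oppr0).
  rewrite oner_eq0; split=> //.
  - move: w_gt0; clear -mi mi1; case: w => x y /= y0.
    move: (_^-1) mi mi1 => k k0 k1.
    have y1 := ltW y0; have k2 := ltW k0; have h : 0 <= 2 - k by lra.
    split=> /=; first by nra.
      by nra.
    rewrite [leRHS](_ : _ = y * k * (2 - k) * (x ^+ 2 + y ^+ 2)); last by ring.
    by repeat first [done | exact: sqr_ge0 | apply: addr_ge0 | apply: mulr_ge0].
  - have -> : ((2 * m)^-1)%:C = ((2 * m)%:C)^-1 :> R[i] by exact: fmorphV.
    by move: (_%:C) m0 => k k0; field.
  - by rewrite -mulrDr -rmorphD subrK rmorph_nat mulr_natr mulr2n.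
have [a_gt0 e_ge0 X_ge0] := cone.
have M_neq0 : w + (e + a) != 0.
  apply: Im_neq0; move: w_gt0 a_gt0 e_ge0; clear.
  by case: w => ? ?; case: a => ? ?; case: e => ? ? /=; lra.
have bS' : b n.+3 = (w + (e + a)) * b n.+2 by rewrite bS cn -mulrDl.
exists ((w * a - 1) / (w + (e + a))),
  ((w * (e + a) - D%:C + (2 * m)%:C * w * a - (w * a - 1)) / (w + (e + a))).
split; first exact: half_plane_cone_step.
- by rewrite bS' mulf_neq0.
- by rewrite AS An bS'; field.
- by rewrite cS An cn bS'; field.
Qed.

(** Dividing [A n] by [s^n], where [s^2 = 1 - z^2], leads back to the previous recurrence at
    [w = z / s]; the sign of [s] is chosen to put [w] in the upper half plane. *)
Lemma homogeneous_cubic_recurrence_nonzero (m D : R) z (A b c : nat -> R[i]) :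
  1 <= D -> D <= 2 * m + 1 -> 1 <= 2 * m -> Im z != 0 ->
  A 0%N = 1 -> b 0%N = 0 -> c 0%N = 0 ->
  (forall n, A n.+1 = z * A n + b n) ->
  (forall n, b n.+1 = z * b n + c n) ->
  (forall n, c n.+1 = z * c n + D%:C * (z ^+ 2 - 1) * b n
                      + (2 * m)%:C * z * (z ^+ 2 - 1) * A n) ->
  forall n, A n != 0.
Proof.
move=> D1 Dm m1 z_neq0 A0 b0 c0 AS bS cS.
have [s s2 [s0 w_gt0]] : exists2 s, s ^+ 2 = 1 - z ^+ 2 & s != 0 /\ 0 < Im (z / s).
  pose r := sqrtC (1 - z ^+ 2).
  have r2 : r ^+ 2 = 1 - z ^+ 2 by rewrite sqrtCK.
  have r0 : r != 0.
    apply/eqP => r0; move: r2; rewrite r0 expr0n /= => /esym/eqP.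
    rewrite subr_eq0 eq_sym sqrf_eq1 => /orP[]/eqP z1; move: z_neq0;
      by rewrite z1 /= ?oppr0 eqxx.
  have [w_lt0|w_gt0|] := ltgtP (Im (z / r)) 0.
  - exists (- r); rewrite ?sqrrN //; split; first by rewrite oppr_eq0.
    by rewrite invrN mulrN; move: w_lt0; case: (_ / _) => ? ? /=; rewrite oppr_gt0.
  - by exists r.
  (* If [z = k r] with [k] real, then [r^2 (1 + k^2) = 1] makes [r] real, hence [z] real. *)
  move=> w0; exfalso.
  have zE : z = z / r * r by rewrite divfK.
  move: r2 z_neq0; rewrite zE exprMn; move: w0; case: (z / r) => k l /= ->.
  case: (r) => p q.
  rewrite !expr2 => /eqP; rewrite eq_complex /= => /andP[/eqP h1 /eqP h2].
  have q0 : q = 0.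
    have : p * q * (1 + k ^+ 2) = 0 by lra.
    have k1 : 1 + k ^+ 2 != 0 by rewrite gt_eqF // ltr_wpDr ?sqr_ge0.
    move/eqP; rewrite !mulf_eq0 (negPf k1) orbF => /orP[/eqP p0|/eqP //].
    have := sqr_ge0 q; have := sqr_ge0 (k * q); rewrite !expr2.
    by move: h1; rewrite p0; lra.
  by rewrite q0 mulr0 mul0r addr0 eqxx.
pose nA n := A n / s ^+ n.
suff nA0 n : nA n != 0 by move=> n; move: (nA0 n); rewrite mulf_eq0 negb_or => /andP[].
have w0 : z / s != 0.
  by apply/eqP => w0; move: w_gt0; rewrite w0 ltxx.
have z0 : z != 0 by apply: contraNneq w0 => ->; rewrite mul0r.
have m0 : (2 * m)%:C != 0 :> R[i].
  by rewrite eq_complex /= eqxx andbT gt_eqF //; lra.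
(* The factor [- 2 m z] makes [A] enter the recurrence of [c] with coefficient 1; [c] carries one
   more power of [s] than [b]. *)
apply: (@cubic_recurrence_nonzero m D (z / s) nA
  (fun n => - b n / ((2 * m)%:C * z * s ^+ n))
  (fun n => - c n / ((2 * m)%:C * z * s ^+ n.+1))) => //.
- by rewrite /nA A0 expr0 divr1.
- by rewrite b0 oppr0 mul0r.
- by rewrite c0 oppr0 mul0r.
all: move=> k; rewrite /nA ?AS ?bS ?cS.
all: have sk : s ^+ k != 0 by rewrite expf_neq0.
all: have z2 : z ^+ 2 - 1 = - s ^+ 2 by rewrite s2; ring.
all: rewrite ?z2 !exprS; move: (s ^+ k) sk (2 * m)%:C m0 => sk sk0 m2 m20.
all: by field; rewrite ?s0 ?m20 ?z0 ?sk0.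
Qed.

End HalfPlane.

(** * Germs of segments in a triangulated triangle *)

Lemma card3P (T : finType) (A : {set T}) : #|A| = 3%N ->
  exists u v w, [/\ u != v, u != w, v != w & A = [set u; v; w]%SET].
Proof.
move=> A3; have /finset.set0Pn[u uA] : A != finset.set0 by rewrite -card_gt0 A3.
have /eqP/cards2P [v [w [vw Ae]]] : #|(A :\ u)%SET| = 2%N.
  by move: A3; rewrite (cardsD1 u) uA => -[].
have: v \in (A :\ u)%SET by rewrite Ae !inE eqxx.
have: w \in (A :\ u)%SET by rewrite Ae !inE eqxx orbT.
rewrite !inE => /andP[wu _] /andP[vu _].
exists u, v, w; split; rewrite 1?[u == _]eq_sym //.
by rewrite -(finset.setD1K uA) Ae finset.setUA.
Qed.

Lemma big_set3 (T : finType) (M : nmodType) (F : T -> M) (u v w : T) :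
  u != v -> u != w -> v != w ->
  \sum_(x in [set u; v; w]%SET) F x = F u + F v + F w.
Proof.
move=> uv uw vw.
rewrite -finset.setUA big_setU1 ?inE ?negb_or ?uv //= big_setU1 ?inE //=.
by rewrite big_set1 addrA.
Qed.

Lemma sum_if_subset (W : finType) (M : nmodType) (A A' : {set W}) (F : W -> M) :
  A' \subset A ->
  \sum_(w in A) (if w \in A' then F w else 0) = \sum_(w in A') F w.
Proof.
move=> sA; rewrite -big_mkcondr; apply: eq_bigl => v.
by rewrite andbC; case: (boolP (v \in A')) => // /(fintype.subsetP sA) ->.
Qed.

(** * Conditions that hold for all small positive parameters *)

Section Small.
Variable R : realFieldType.

Lemma finite_small (T : finType) (P : T -> R -> Prop) :
  (forall x, exists2 e0, 0 < e0 & forall e, 0 < e -> e < e0 -> P x e) ->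
  exists2 e0, 0 < e0 & forall x e, 0 < e -> e < e0 -> P x e.
Proof.
move=> sm.
suff [e0 e00 He] : exists2 e0, 0 < e0 &
    forall x e, x \in enum T -> 0 < e -> e < e0 -> P x e.
  by exists e0 => // x e; apply: He; rewrite mem_enum.
elim: (enum T) => [|x s [e1 e10 IH]]; first by exists 1.
have [e2 e20 Hx] := sm x.
exists (Num.min e1 e2); first by rewrite lt_min e10.
move=> y e; rewrite inE lt_min => /orP[/eqP -> e_gt0 /andP[_]|ys e_gt0 /andP[+ _]].
  exact: Hx.
exact: IH.
Qed.

Lemma affine_small (c m : R) : 0 <= c -> (c = 0 -> 0 < m) ->
  exists2 e0, 0 < e0 & forall e, 0 < e -> e < e0 -> 0 <= c + e * m.
Proof.
rewrite le_eqVlt => /orP[/eqP <- /(_ erefl) m0|c0 _].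
  by exists 1 => // e e0 _; rewrite add0r mulr_ge0 // ltW.
exists (c / (`|m| + 1)); first by rewrite divr_gt0 // ltr_wpDl.
move=> e e0; rewrite ltr_pdivlMr ?ltr_wpDl // => ec.
have := ler_norm (- m); rewrite normrN => mm; nra.
Qed.
End Small.

(** * Convex hulls, barycentric coordinates and germs of segments *)

Section Hulls.
Variables (R : realType) (W : finType) (p : W -> 'rV[R]_2).
Implicit Types (A : {set W}) (c d x : 'rV[R]_2) (a : W -> R).

Lemma hull_convex A x y (l : R) : 0 <= l <= 1 -> hull p A x -> hull p A y ->
  hull p A (x + l *: (y - x)).
Proof.
move=> /andP[l0 l1] [a [a0 a1 ->]] [b [b0 b1 ->]].
exists (fun w => a w + l * (b w - a w)); split.
- move=> w wA; have := a0 _ wA; have := b0 _ wA; nra.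
- by rewrite big_split /= -mulr_sumr big_split /= sumrN a1 b1; ring.
rewrite -sumrB scaler_sumr -big_split /=; apply: eq_bigr => w _.
by rewrite -scalerBl scalerA scalerDl.
Qed.

Lemma affinely_independent_eq A a b : affinely_independent p A ->
  \sum_(w in A) a w = \sum_(w in A) b w ->
  \sum_(w in A) a w *: p w = \sum_(w in A) b w *: p w ->
  forall w, w \in A -> a w = b w.
Proof.
move=> iA sab pab w wA; apply/eqP; rewrite -subr_eq0; apply/eqP.
apply: (iA (fun w => a w - b w)) => //; first by rewrite sumrB sab subrr.
under eq_bigr do rewrite scalerBl.
by rewrite sumrB pab subrr.
Qed.

Lemma affinely_independent_sub A A' : A \subset A' ->
  affinely_independent p A' -> affinely_independent p A.
Proof.
move=> sA iA a a0 ap w wA.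
have := iA (fun w => if w \in A then a w else 0); rewrite sum_if_subset // => /(_ a0).
rewrite -[X in X = 0 -> _](_ : \sum_(w in A') (if w \in A then a w *: p w else 0) = _).
  by rewrite sum_if_subset // => /(_ ap w (fintype.subsetP sA _ wA)); rewrite wA.
by apply: eq_bigr => v _; case: ifP; rewrite ?scale0r.
Qed.

(** The starting point, at parameter 0, is left out; that it lies in the hull has to be derived. *)
Definition germ A c d :=
  exists2 e0 : R, 0 < e0 & forall e, 0 < e -> e < e0 -> hull p A (c + e *: d).

(** For a nondegenerate triangle, a weight vanishes exactly when [d] is parallel to the opposite
    edge, so the last condition expresses that [d] is generic. *)
Definition direction_weights A d (mu : W -> R) :=
  [/\ \sum_(w in A) mu w = 0, \sum_(w in A) mu w *: p w = d
    & forall w, w \in A -> mu w != 0].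

(** Along the segment the coordinates are [a w + e * mu w]: a positive one stays nonnegative for
    small [e], a zero one has to increase. *)
Lemma germP A c d mu a : affinely_independent p A -> direction_weights A d mu ->
  (forall w, w \in A -> 0 <= a w) -> \sum_(w in A) a w = 1 ->
  c = \sum_(w in A) a w *: p w ->
  germ A c d <-> (forall w, w \in A -> a w = 0 -> 0 < mu w).
Proof.
move=> iA [mu0 mud mun] a0 a1 ->.
have sumE e : \sum_(w in A) (a w + e * mu w) = 1.
  by rewrite big_split /= -mulr_sumr a1 mu0 mulr0 addr0.
have combE e : \sum_(w in A) (a w + e * mu w) *: p w
    = \sum_(w in A) a w *: p w + e *: d.
  rewrite -mud scaler_sumr -big_split; apply: eq_bigr => w _ /=.
  by rewrite scalerDl scalerA.
split=> [[e0 e00 He] w wA aw|pos].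
  have e2 : 0 < e0 / 2 by rewrite divr_gt0.
  have [|b [b0 b1]] := He _ e2; first by lra.
  rewrite -combE => bE.
  have := affinely_independent_eq iA _ bE; rewrite sumE b1 => /(_ erefl _ wA).
  rewrite aw add0r => bw; have := b0 _ wA; rewrite -bw pmulr_rge0 // => mw.
  by rewrite lt_def mun.
have [|e0 e00 He] := @finite_small R W (fun w e => w \in A -> 0 <= a w + e * mu w).
  move=> w; case: (boolP (w \in A)) => wA; last by exists 1.
  have [e0 e00 He] := affine_small (a0 _ wA) (pos _ wA).
  by exists e0 => // e *; apply: He.
exists e0 => // e e_gt0 elt; exists (fun w => a w + e * mu w).
by split=> // w wA; apply: He.
Qed.

(** The direction is the difference of two points of the germ divided by the difference of their
    parameters. *)
Lemma germ_combination A c d : germ A c d -> exists nu : W -> R,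
  \sum_(w in A) nu w = 0 /\ \sum_(w in A) nu w *: p w = d.
Proof.
move=> [e0 e00 He].
have e2 : 0 < e0 / 2 by lra.
have e3 : 0 < e0 / 3 by lra.
have [|a [_ a1 aE]] := He _ e2; first by lra.
have [|b [_ b1 bE]] := He _ e3; first by lra.
have ne : e0 / 2 - e0 / 3 != 0 by rewrite gt_eqF //; lra.
exists (fun w => (a w - b w) / (e0 / 2 - e0 / 3)); split.
  by rewrite -mulr_suml sumrB a1 b1 subrr mul0r.
under eq_bigr do rewrite mulrC -scalerA scalerBl.
rewrite -scaler_sumr sumrB -aE -bE opprD addrACA subrr add0r -scalerBl.
by rewrite scalerA mulVf // scale1r.
Qed.

(** By convexity, a hull met at arbitrarily small parameters contains a whole germ. If no member of
    [K] did, all of them would miss the segment near [c]. *)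
Lemma germ_finite_union (K : {set {set W}}) A c d : germ A c d ->
  (forall x, hull p A x -> exists2 s, s \in K & hull p s x) ->
  exists2 s, s \in K & germ s c d.
Proof.
move=> [e0 e00 gA] cov; apply: contrapT => noK.
have [|e1 e10 He] := @finite_small R {set W}
    (fun s e => s \in K -> ~ hull p s (c + e *: d)).
  move=> s; apply: contrapT => ns; apply: noK; exists s.
    by apply: contrapT => sK; apply: ns; exists 1.
  have pt e' : 0 < e' -> exists e, [/\ 0 < e, e < e' & hull p s (c + e *: d)].
    move=> e'0; apply: contrapT => ne; apply: ns; exists e' => // e e0' ee' _ hs.
    by apply: ne; exists e.
  have [e2 [e20 _ h2]] := pt 1 ltr01.
  exists e2 => // e ep elt; have [e3 [e30 e3e h3]] := pt _ ep.
  have d0 : 0 < e2 - e3 by lra.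
  (* The parameter [e] lies between [e3] and [e2], both of which give points of the hull. *)
  have -> : c + e *: d = c + e3 *: d
      + ((e - e3) / (e2 - e3)) *: (c + e2 *: d - (c + e3 *: d)).
    rewrite opprD addrACA subrr add0r -scalerBl scalerA divfK ?gt_eqF //.
    by rewrite -addrA -scalerDl [e3 + _]addrC subrK.
  apply: hull_convex => //; apply/andP; split.
    by rewrite divr_ge0 //; lra.
  by rewrite ler_pdivrMr //; lra.
pose e := Num.min e0 e1 / 2.
have e_gt0 : 0 < e by rewrite divr_gt0 // lt_min e00.
have [l0 l1] : e < e0 /\ e < e1.
  have : Num.min e0 e1 <= e0 by rewrite ge_min lexx.
  have : Num.min e0 e1 <= e1 by rewrite ge_min lexx orbT.
  move: e_gt0; rewrite /e; move: (Num.min _ _) => z; split; lra.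
have [s sK hs] := cov _ (gA _ e_gt0 l0).
exact: He hs.
Qed.

End Hulls.

(** * Generic directions in the plane and their weights *)

Section Directions.
Variables (R : realType) (W : finType) (p : W -> 'rV[R]_2).
Implicit Types (A : {set W}) (k : R).

Definition direction k : 'rV[R]_2 := \row_j (if j == 0 then 1 else k).

(** A linear form that kills [direction k]; its injectivity on a vertex set says that no segment
    between two of these vertices is parallel to that direction. *)
Definition height k (w : W) : R := k * p w 0 0 - p w 0 1.

Lemma row2P (x y : 'rV[R]_2) : x 0 0 = y 0 0 -> x 0 1 = y 0 1 -> x = y.
Proof.
move=> e0 e1; apply/rowP => -[[|[|//]] lt].
  by rewrite (_ : Ordinal lt = 0) //; apply: val_inj.
by rewrite (_ : Ordinal lt = 1) //; apply: val_inj.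
Qed.

Lemma sum_entry A (a : W -> R) (j : 'I_2) :
  (\sum_(w in A) a w *: p w) 0 j = \sum_(w in A) a w * p w 0 j.
Proof. by rewrite summxE; apply: eq_bigr => w _; rewrite !mxE. Qed.

Lemma sum_height A (a : W -> R) k : \sum_(w in A) a w * height k w
  = k * (\sum_(w in A) a w * p w 0 0) - \sum_(w in A) a w * p w 0 1.
Proof.
by rewrite mulr_sumr -sumrB; apply: eq_bigr => w _; rewrite /height; ring.
Qed.

Lemma direction_sumE A (a : W -> R) k : \sum_(w in A) a w *: p w = direction k ->
  \sum_(w in A) a w * p w 0 0 = 1 /\ \sum_(w in A) a w * height k w = 0.
Proof.
move=> e; have e0 : \sum_(w in A) a w * p w 0 0 = 1.
  by rewrite -sum_entry e mxE eqxx.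
have e1 : \sum_(w in A) a w * p w 0 1 = k.
  by rewrite -sum_entry e mxE.
by rewrite sum_height e0 e1 mulr1 subrr.
Qed.

Lemma sumE_direction A (a : W -> R) k :
  \sum_(w in A) a w * p w 0 0 = 1 -> \sum_(w in A) a w * height k w = 0 ->
  \sum_(w in A) a w *: p w = direction k.
Proof.
move=> e0 eh; apply: row2P; rewrite sum_entry mxE //=.
by move/eqP: eh; rewrite sum_height e0 mulr1 subr_eq0 eq_sym => /eqP.
Qed.

(** Two points of equal height have slope [k], so [k] is taken above the sum of all absolute slopes.
    Pairs on a vertical line contribute 0, as division by 0 gives 0; there equal heights already
    force equal points. *)
Lemma exists_generic_direction A : {in A &, injective p} ->
  exists k, {in A &, injective (height k)}.
Proof.
move=> pinj; pose q u v : R := `|(p u 0 1 - p v 0 1) / (p u 0 0 - p v 0 0)|.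
pose k := 1 + \sum_(u in A) \sum_(v in A) q u v; exists k => u v uA vA hh.
have e : k * (p u 0 0 - p v 0 0) = p u 0 1 - p v 0 1.
  by move: hh; rewrite /height => hh; lra.
have [g0|g0] := eqVneq (p u 0 0 - p v 0 0) 0.
  by apply: pinj => //; apply: row2P; move: e; rewrite ?g0; lra.
have kE : k = (p u 0 1 - p v 0 1) / (p u 0 0 - p v 0 0) by rewrite -e mulfK.
have : k <= q u v by rewrite [leLHS]kE ler_norm.
have : q u v <= \sum_(u in A) \sum_(v in A) q u v.
  have q0 x y : 0 <= q x y by exact: normr_ge0.
  rewrite (bigD1 u) //= (bigD1 v) //= -addrA lerDl addr_ge0 ?sumr_ge0 //.
  by move=> x _; rewrite sumr_ge0.
by rewrite /k => ? ?; exfalso; lra.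
Qed.

Lemma exists_direction_weights A k : {in A &, injective (height k)} ->
  #|A| = 3%N -> affinely_independent p A ->
  exists mu, direction_weights p A (direction k) mu.
Proof.
move=> hinj /card3P[u [v [w [uv uw vw AE]]]] iA.
have [uA vA wA] : [/\ u \in A, v \in A & w \in A] by rewrite AE !inE !eqxx !orbT.
have hdiff x y : x \in A -> y \in A -> x != y -> height k x - height k y != 0.
  by move=> xA yA; apply: contraNneq => /subr0_eq /hinj ->.
(* Cyclic differences of heights solve both linear equations, sum 0 and total height 0; dividing by
   [De] makes the first coordinate 1. *)
pose f x := if x == u then height k v - height k w
            else if x == v then height k w - height k u else height k u - height k v.
have fE : [/\ f u = height k v - height k w, f v = height k w - height k u
            & f w = height k u - height k v].
  by rewrite /f !eqxx ![_ == u]eq_sym [w == v]eq_sym (negPf uv) (negPf uw) (negPf vw).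
have [fu fv fw] := fE.
have sf : \sum_(x in A) f x = 0 by rewrite AE big_set3 // fu fv fw; ring.
have sh : \sum_(x in A) f x * height k x = 0.
  by rewrite AE big_set3 // fu fv fw; ring.
have f0 x : x \in A -> f x != 0.
  rewrite AE !inE -orbA => /or3P[]/eqP ->; rewrite ?fu ?fv ?fw hdiff //.
  by rewrite eq_sym.
set De := \sum_(x in A) f x * p x 0 0.
(* Otherwise [f] would be a nontrivial affine dependency. *)
have De0 : De != 0.
  apply/eqP => De0; have /eqP := f0 _ uA; apply.
  apply: (iA f) => //; apply: row2P; rewrite sum_entry mxE //.
  by move: sh; rewrite sum_height -/De De0; lra.
have scal F : \sum_(x in A) f x / De * F x = (\sum_(x in A) f x * F x) / De.
  by rewrite mulr_suml; apply: eq_bigr => x _; rewrite mulrAC.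
exists (fun x => f x / De); split.
- by rewrite -mulr_suml sf mul0r.
- apply: sumE_direction.
    by rewrite scal divff.
  by rewrite scal sh mul0r.
- by move=> x xA; rewrite mulf_neq0 ?invr_eq0 // f0.
Qed.

(** The coefficients of [d] over [A] are unique, and those carried by [A1] are all nonzero. *)
Lemma direction_weights_subset A A1 A2 d (mu nu : W -> R) :
  affinely_independent p A -> A1 \subset A -> A2 \subset A ->
  direction_weights p A1 d mu ->
  \sum_(w in A2) nu w = 0 -> \sum_(w in A2) nu w *: p w = d -> A1 \subset A2.
Proof.
move=> iA s1 s2 [mu0 mud mun] nu0 nud; apply/fintype.subsetP => w w1.
apply: contraT => w2; have /eqP := mun _ w1; case.
have := @affinely_independent_eq _ _ p A (fun w => if w \in A1 then mu w else 0)
  (fun w => if w \in A2 then nu w else 0) iA.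
rewrite !sum_if_subset // mu0 nu0 => /(_ erefl).
have scl A' (F : W -> R) : \sum_(w in A) (if w \in A' then F w else 0) *: p w
    = \sum_(w in A) (if w \in A' then F w *: p w else 0).
  by apply: eq_bigr => v _; case: ifP; rewrite ?scale0r.
rewrite !scl !sum_if_subset // mud nud => /(_ erefl w (fintype.subsetP s1 _ w1)).
by rewrite w1 (negPf w2).
Qed.

(** With four points, two triples differing in one element would both carry nonzero weights for the
    same direction, against uniqueness. *)
Lemma affinely_independent_card A k : {in A &, injective (height k)} ->
  affinely_independent p A -> (#|A| <= 3)%N.
Proof.
move=> hinj iA; rewrite leqNgt; apply/negP => A3.
have : (0 < #|[set A' : {set W} | A' \subset A & #|A'| == 3%N]%SET|)%N.
  by rewrite cards_draws bin_gt0 ltnW.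
rewrite card_gt0 => /finset.set0Pn[A1]; rewrite inE => /andP[s1 /eqP c1].
have weights A' : A' \subset A -> #|A'| = 3%N ->
    exists mu, direction_weights p A' (direction k) mu.
  move=> sA cA; apply: exists_direction_weights => //.
    by move=> u v /(fintype.subsetP sA) uA /(fintype.subsetP sA); apply: hinj.
  exact: affinely_independent_sub iA.
have /properP[_ [x xA x1]] : A1 \proper A by rewrite properEcard s1 c1.
have /finset.set0Pn[u u1] : A1 != finset.set0 by rewrite -card_gt0 c1.
have s2 : (x |: (A1 :\ u))%SET \subset A.
  rewrite finset.subUset finset.sub1set xA; exact: fintype.subset_trans (finset.subsetDl _ _) s1.
have [mu1 [m1 d1 _]] := weights _ s1 c1.
have [|mu2 w2] := weights _ s2.
  by rewrite cardsU1 !inE negb_and x1 orbT add1n; move: c1; rewrite (cardsD1 u) u1.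
have /fintype.subsetP/(_ x) := direction_weights_subset iA s2 s1 w2 m1 d1.
by rewrite !inE eqxx (negPf x1) => /(_ isT).
Qed.

(** On at most two points of distinct heights, sum 0 and total height 0 force all coefficients to
    vanish, whereas the direction has first coordinate 1. *)
Lemma direction_sum_card A k (a : W -> R) : {in A &, injective (height k)} ->
  \sum_(w in A) a w = 0 -> \sum_(w in A) a w *: p w = direction k ->
  (2 < #|A|)%N.
Proof.
move=> hinj a0 /direction_sumE[ag ah]; rewrite ltnNge; apply/negP => A2.
suff a00 w : w \in A -> a w = 0.
  by move: ag; rewrite big1 => [/esym/eqP|w /a00 ->]; rewrite ?oner_eq0 ?mul0r.
case: (ltngtP #|A| 1) A2 => [|c2 A2 wA|/eqP/cards1P[x AE] _].
- by rewrite ltnS leqn0 => /eqP/cards0_eq -> _; rewrite inE.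
- have /cards2P[x [y [xy AE]]] : #|A| == 2%N by rewrite eqn_leq A2.
  have [xA yA] : x \in A /\ y \in A by rewrite AE !inE !eqxx orbT.
  move: a0 ah; rewrite AE !big_setU1 ?inE //= !big_set1 => a0 ah.
  have h0 : height k x - height k y != 0.
    by apply: contraNneq xy => /subr0_eq /hinj ->.
  have ax : a x = 0.
    apply: (mulIf h0); rewrite mul0r; move: ah.
    have -> : a y = - a x by lra.
    by move=> <-; ring.
  by move: wA; rewrite AE !inE => /orP[]/eqP -> //; lra.
- by move: a0; rewrite AE big_set1 inE => a0 /eqP ->.
Qed.

End Directions.

(** * Local structure of a triangulated triangle along a generic direction *)

Section Triangulation.
Variables (R : realType) (W : finType) (p : W -> 'rV[R]_2).
Variables (L : {set {set W}}) (B : {set W}) (k : R) (mu : {set W} -> W -> R).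
Hypotheses (LC : simplicial_complex L) (LG : geometric_triangulation p L B).
Hypothesis hinj : {in vertices L &, injective (height p k)}.
Implicit Types (A s t e : {set W}) (b : bool).

Definition nondegenerate_triangle A :=
  [/\ A \subset vertices L, #|A| = 3%N & affinely_independent p A].

Hypothesis muP : forall A, nondegenerate_triangle A ->
  direction_weights p A (direction k) (mu A).

Definition signed_direction b : 'rV[R]_2 := (-1) ^+ b *: direction k.

Definition bary s : 'rV[R]_2 := \sum_(w in s) #|s|%:R^-1 *: p w.

(* The segment from an interior point of the face s in direction +-d starts
   inside the triangle A. *)
Definition enters A s b := [forall w in A :\: s, 0 < (-1) ^+ b * mu A w]%SET.

Lemma signed_weights A b : nondegenerate_triangle A ->
  direction_weights p A (signed_direction b) (fun w => (-1) ^+ b * mu A w).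
Proof.
move=> /muP[mu0 mud mun]; split.
- by rewrite -mulr_sumr mu0 mulr0.
- by rewrite /signed_direction -mud scaler_sumr; apply: eq_bigr => w; rewrite scalerA.
- by move=> w wA; rewrite mulf_neq0 ?signr_eq0 // mun.
Qed.

Lemma face_vertices s : s \in L -> s \subset vertices L.
Proof.
move=> sL; apply/fintype.subsetP => v vs; rewrite inE.
by apply: LC.2 sL _; rewrite finset.sub1set.
Qed.

Lemma face_independent s : s \in L -> affinely_independent p s.
Proof. by case: LG => _ + _ _ _; apply. Qed.

Lemma face_height_inj s : s \in L -> {in s &, injective (height p k)}.
Proof.
move=> /face_vertices/fintype.subsetP sV u v /sV uV /sV vV; exact: hinj.
Qed.

Lemma face_card s : s \in L -> (#|s| <= 3)%N.
Proof.
move=> sL; apply: (affinely_independent_card (face_height_inj sL)).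
exact: face_independent.
Qed.

Lemma triangle_nondegenerate t : t \in L -> #|t| = 3%N -> nondegenerate_triangle t.
Proof. by move=> tL t3; split; [exact: face_vertices| |exact: face_independent]. Qed.

Lemma frame_nondegenerate : nondegenerate_triangle B.
Proof. by case: LG => -[]. Qed.

Lemma sum_bary_coef s : s != finset.set0 -> \sum_(w in s) (#|s|%:R^-1 : R) = 1.
Proof.
move=> s0; rewrite sumr_const -[LHS]mulr_natr mulVf // pnatr_eq0.
by rewrite -lt0n card_gt0.
Qed.

Lemma bary_hull s : s != finset.set0 -> hull p s (bary s).
Proof.
move=> s0; exists (fun=> #|s|%:R^-1); split=> //; last exact: sum_bary_coef.
by move=> w _; rewrite invr_ge0.
Qed.

Lemma germ_bary A s b : nondegenerate_triangle A -> s \subset A -> s != finset.set0 ->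
  germ p A (bary s) (signed_direction b) <-> enters A s b.
Proof.
move=> ndA sA s0; have [_ _ iA] := ndA.
have s_gt0 : 0 < (#|s|%:R^-1 : R) by rewrite invr_gt0 ltr0n card_gt0.
have -> : germ p A (bary s) (signed_direction b) <-> (forall w, w \in A ->
    (if w \in s then #|s|%:R^-1 else 0 : R) = 0 -> 0 < (-1) ^+ b * mu A w).
  apply: (germP iA (signed_weights b ndA)).
  - by move=> w _; case: ifP => // _; apply: ltW.
  - by rewrite sum_if_subset // sum_bary_coef.
  - rewrite /bary -(sum_if_subset _ sA); apply: eq_bigr => w _.
    by case: ifP => //; rewrite scale0r.
split=> [pos|/forall_inP ent w wA].
  apply/forall_inP => w; rewrite inE => /andP[/negPf ws wA].
  by apply: pos; rewrite // ws.
case: ifP => [_ /eqP|ws _]; first by rewrite gt_eqF.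
by apply: ent; rewrite inE ws.
Qed.

Lemma hull_face_sub s x : s \in L -> hull p s x -> hull p B x.
Proof.
case: LG => _ _ _ cov _ sL hx.
have : (\bigcup_(s in [set` L]) hull p s)%classic x by exists s.
by rewrite cov.
Qed.

Lemma hull_cover x : hull p B x -> exists2 s, s \in L & hull p s x.
Proof.
by case: LG => _ _ _ cov _; rewrite -cov => -[s sL hs]; exists s.
Qed.

(** One of the finitely many faces contains a germ, and a face with at most two vertices cannot
    carry a generic direction. Its hull is closed, hence contains [c] too. *)
Lemma germ_face c b : germ p B c (signed_direction b) ->
  exists t, [/\ t \in L, #|t| = 3%N, germ p t c (signed_direction b) & hull p t c].
Proof.
move=> /germ_finite_union/(_ hull_cover)[t tL gt].
exists t; have [e0 e00 He] := gt.
have it := face_independent tL.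
have e2 : 0 < e0 / 2 by lra.
have [|a [a0 a1 aE]] := He _ e2; first by lra.
have [nu [nu0 nud]] := germ_combination gt.
have t3 : #|t| = 3%N.
  apply/eqP; rewrite eqn_leq face_card //=.
  apply: (@direction_sum_card _ _ p t k (fun w => (-1) ^+ b * nu w)).
  - exact: face_height_inj.
  - by rewrite -mulr_sumr nu0 mulr0.
  - under eq_bigr do rewrite -scalerA.
    by rewrite -scaler_sumr nud scalerA -signr_addb addbb scale1r.
have ndt := triangle_nondegenerate tL t3.
split=> //; have [m0 md mn] := signed_weights b ndt.
pose m w := (-1) ^+ b * mu t w.
(* Stepping back from the point at parameter [e0 / 2] yields the coordinates of [c]. *)
have cE : c = \sum_(w in t) (a w - e0 / 2 * m w) *: p w.
  under eq_bigr do rewrite scalerBl -scalerA.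
  by rewrite sumrB -scaler_sumr -aE md addrK.
have c1 : \sum_(w in t) (a w - e0 / 2 * m w) = 1.
  by rewrite sumrB -mulr_sumr a1 m0 mulr0 subr0.
exists (fun w => a w - e0 / 2 * m w); split=> // w wt.
set g := a w - e0 / 2 * m w; rewrite leNgt; apply/negP => g0.
have key (e : R) : 0 < e -> e < e0 -> 0 <= g + e * m w.
  move=> ep elt; have [f [f0 f1 fE]] := He e ep elt.
  have -> : g + e * m w = f w; last exact: f0.
  have := @affinely_independent_eq _ _ p t
    (fun w => a w - e0 / 2 * m w + e * m w) f it; apply=> //.
  - by rewrite big_split /= c1 -mulr_sumr m0 mulr0 addr0.
  - under eq_bigr do rewrite scalerDl -[(e * _) *: _]scalerA.
    by rewrite big_split /= -cE -scaler_sumr md.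
(* A negative [g] would keep [g + e * m w] at most [g / 2] for small [e], against [key]. *)
have [||e1 e10 H1] := @affine_small R (- g / 2) (- m w).
- by lra.
- by lra.
have emin : 0 < Num.min e1 e0 / 2 by rewrite divr_gt0 // lt_min e10.
have [l0 l1] : Num.min e1 e0 / 2 < e0 /\ Num.min e1 e0 / 2 < e1.
  have : Num.min e1 e0 <= e1 by rewrite ge_min lexx.
  have : Num.min e1 e0 <= e0 by rewrite ge_min lexx orbT.
  by move: emin; move: (Num.min _ _) => z; split; lra.
have := H1 _ emin l1; have := key _ emin l0; rewrite mulrN; lra.
Qed.

(** The common germ lies in the hull of [t :&: t'], so the direction is a combination of these
    vertices; its weights on [t] and on [t'] being nonzero, the intersection is everything. *)
Lemma germ_unique c b t t' : t \in L -> t' \in L -> #|t| = 3%N -> #|t'| = 3%N ->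
  germ p t c (signed_direction b) -> germ p t' c (signed_direction b) -> t = t'.
Proof.
move=> tL tL' t3 t3' [e0 e00 H0] [e1 e10 H1].
have [|f f0 Hf] := @finite_small R bool
    (fun (i : bool) (e : R) => hull p (if i then t else t') (c + e *: signed_direction b)).
  by case; [exists e0 | exists e1].
suff sub : t \subset (t :&: t')%SET /\ t' \subset (t :&: t')%SET.
  case: sub; rewrite !finset.subsetI => /andP[_ tt'] /andP[t't _].
  by apply/eqP; rewrite finset.eqEsubset tt'.
have [nu [nu0 nud]] : exists nu : W -> R, \sum_(w in t :&: t') nu w = 0 /\
    \sum_(w in t :&: t') nu w *: p w = signed_direction b.
  apply: (@germ_combination _ _ p _ c); exists f => // e ep elt.
  case: LG => _ _ cap _ _; rewrite -cap //.
  by split; [exact: (Hf true)|exact: (Hf false)].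
have w1 := signed_weights b (triangle_nondegenerate tL t3).
have w2 := signed_weights b (triangle_nondegenerate tL' t3').
split.
  apply: direction_weights_subset w1 nu0 nud => //; last exact: finset.subsetIl.
  exact: face_independent.
apply: direction_weights_subset w2 nu0 nud => //; last exact: finset.subsetIr.
exact: face_independent.
Qed.

(** All coordinates of the barycenter are positive, so no vertex of [s] can be dispensed with. *)
Lemma bary_face s t : s != finset.set0 -> affinely_independent p s ->
  hull p (s :&: t)%SET (bary s) -> s \subset t.
Proof.
move=> s0 is_ [a [a0 a1 aE]]; apply/fintype.subsetP => w ws.
apply: contraT => wt.
have := @affinely_independent_eq _ _ p s (fun=> #|s|%:R^-1)
  (fun w => if w \in (s :&: t)%SET then a w else 0) is_.
rewrite sum_if_subset ?finset.subsetIl // a1 sum_bary_coef // => /(_ erefl).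
move=> /(_ _ _ ws); rewrite inE ws (negPf wt) /= => H.
have /eqP : (#|s|%:R^-1 : R) = 0.
  apply: H; rewrite -/(bary s) aE -(sum_if_subset _ (finset.subsetIl s t)).
  by apply: eq_bigr => v _; case: ifP => //; rewrite scale0r.
by rewrite invr_eq0 pnatr_eq0 -leqn0 leqNgt card_gt0 s0.
Qed.

Definition triangles := [set t in L | #|t| == 3%N]%SET.

Lemma triangleP t : reflect (t \in L /\ #|t| = 3%N) (t \in triangles).
Proof. by rewrite inE; apply: (iffP andP) => -[? /eqP]. Qed.

(** Existence comes from [germ_face], uniqueness from [germ_unique]; the 2-face found contains the
    barycenter of [s], hence [s] itself. *)
Lemma sum_enters s b : s \in L -> s != finset.set0 ->
  (\sum_(t in triangles | s \subset t) enters t s b)%N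
  = `[< germ p B (bary s) (signed_direction b) >].
Proof.
move=> sL s0.
have entP t : t \in triangles -> s \subset t -> 
    enters t s b <-> germ p t (bary s) (signed_direction b).
  by move=> /triangleP[tL t3] st; rewrite germ_bary //; exact: triangle_nondegenerate.
case: asboolP => [gB|ngB]; last first.
  rewrite big1 // => t /andP[tT st]; apply/eqP; rewrite eqb0; apply/negP.
  move=> /(entP _ tT st)[e0 e00 He]; apply: ngB; exists e0 => // e ep elt.
  by have /triangleP[tL _] := tT; apply: hull_face_sub (He _ ep elt).
have [t [tL t3 gt hc]] := germ_face gB.
have tT : t \in triangles by apply/triangleP.
have st : s \subset t.
  apply: bary_face => //; first exact: face_independent.
  by case: LG => _ _ cap _ _; rewrite -cap //; split=> //; apply: bary_hull.
rewrite (bigD1 t) ?tT //= big1 ?addn0; last first.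
  move=> t' /andP[/andP[t'T st'] tt']; apply/eqP; rewrite eqb0.
  apply: contraNN tt' => /(entP _ t'T st') gt'; have /triangleP[t'L t'3] := t'T.
  by apply/eqP; apply: germ_unique gt' gt.
by rewrite (iffRL (entP _ tT st) gt).
Qed.

(* The weights are nonzero with sum 0, so one has a sign opposite to the two
   others: its vertex is the one of middle height. *)
Lemma sum_enters_vertex A : nondegenerate_triangle A ->
  (\sum_(v in A) \sum_(b : bool) enters A [set v] b = 1)%N.
Proof.
move=> ndA; have [_ /card3P[u [v [w [uv uw vw AE]]]] _] := ndA.
have [mu0 _ mun] := muP ndA.
have [uA vA wA] : [/\ u \in A, v \in A & w \in A] by rewrite AE !inE !eqxx !orbT.
have entE x y z b : x != y -> x != z -> A = [set x; y; z]%SET ->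
    enters A [set x] b = (0 < (-1) ^+ b * mu A y) && (0 < (-1) ^+ b * mu A z).
  move=> xy xz AE'; apply/forall_inP/andP => [H|[Hy Hz] a].
    by split; apply: H; rewrite {1}AE' !inE !eqxx ?orbT andbT eq_sym.
  by rewrite {1}AE' !inE => /andP[/negPf-> /=] /orP[]/eqP ->.
have pe : A = [set v; u; w]%SET by rewrite AE (finset.setUC [set u]%SET).
have pe' : A = [set w; u; v]%SET.
  by rewrite AE finset.setUC finset.setUA.
rewrite {1}AE big_set3 // !big_bool.
rewrite !(entE u v w) // !(entE v u w) 1?[v == u]eq_sym //.
rewrite !(entE w u v) 1?[w == _]eq_sym // !expr0 !expr1 !mul1r !mulN1r !oppr_gt0.
have sgn x : x \in A -> (mu A x < 0) = ~~ (0 < mu A x).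
  by move=> /mun x0; rewrite -leNgt le_eqVlt (negPf x0).
move: mu0; rewrite {1}AE big_set3 // !sgn //.
case: (ltrgtP (mu A u) 0) (mun _ uA) => //; case: (ltrgtP (mu A v) 0) (mun _ vA) => //.
all: case: (ltrgtP (mu A w) 0) (mun _ wA) => // h1 _ h2 _ h3 _ h;
  exfalso; clear -h1 h2 h3 h; lra.
Qed.

(** Only the weight of the vertex opposite [e] matters, and it has exactly one sign. *)
Lemma sum_enters_edge A e : nondegenerate_triangle A -> e \subset A -> #|e| = 2%N ->
  (\sum_(b : bool) enters A e b = 1)%N.
Proof.
move=> ndA eA e2; have [_ A3 _] := ndA; have [_ _ mun] := muP ndA.
have /eqP/cards1P[x xE] : #|A :\: e|%SET = 1%N by rewrite cardsDS // A3 e2.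
have /setDP[xA _] : x \in (A :\: e)%SET by rewrite xE inE.
have entE b : enters A e b = (0 < (-1) ^+ b * mu A x).
  rewrite /enters xE; apply/forall_inP/idP => [|H y]; first by apply; rewrite inE.
  by rewrite inE => /eqP ->.
rewrite big_bool !entE expr0 expr1 mul1r mulN1r oppr_gt0.
by case: ltrgtP (mun _ xA).
Qed.

Lemma vertex_coordinates v : v \in vertices L -> exists a : W -> R,
  [/\ forall w, w \in B -> 0 <= a w, \sum_(w in B) a w = 1
    & p v = \sum_(w in B) a w *: p w].
Proof.
rewrite inE => vL; apply: (hull_face_sub vL).
by exists (fun=> 1); split; rewrite ?big_set1 ?scale1r.
Qed.

(** A zero coordinate puts [v] on a side of the frame, where all vertices are corners; [v] is not
    [w], whose own coordinate is 1. *)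
Lemma zero_coordinate_frame v w (a : W -> R) : v \in vertices L -> w \in B ->
  (forall x, x \in B -> 0 <= a x) -> \sum_(x in B) a x = 1 ->
  p v = \sum_(x in B) a x *: p x -> a w = 0 -> v \in (B :\ w)%SET.
Proof.
move=> vV wB a0 a1 aE aw.
have [_ _ iB] := frame_nondegenerate.
have vB : v \in B.
  case: LG => _ _ _ _ /(_ v (B :\ w)%SET vV); apply.
    by apply/properP; split; [exact: finset.subD1set|exists w; rewrite // !inE eqxx].
  exists a; split=> [x /setD1P[_ /a0]||] //.
    by rewrite -a1 [in RHS](big_setD1 w) //= aw add0r.
  by rewrite aE (big_setD1 w) //= aw scale0r add0r.
rewrite !inE vB andbT; apply/eqP => vw.
have := @affinely_independent_eq _ _ p B
  (fun x => if x \in [set w]%SET then 1 else 0) a iB.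
rewrite sum_if_subset ?finset.sub1set // big_set1 a1 => /(_ erefl).
move=> /(_ _ _ wB); rewrite aw inE eqxx => H.
suff /eqP : (1 : R) = 0 by rewrite oner_eq0.
apply: H; rewrite -aE vw -[RHS](big_set1 +%R w p).
rewrite -(sum_if_subset _ (_ : [set w] \subset B)%SET).
  by apply: eq_bigr => x _; case: ifP; rewrite ?scale1r ?scale0r.
by rewrite finset.sub1set.
Qed.

Lemma exists_vertex_coordinates : exists a : W -> W -> R,
  forall v, v \in vertices L ->
  [/\ forall w, w \in B -> 0 <= a v w, \sum_(w in B) a v w = 1
    & p v = \sum_(w in B) a v w *: p w].
Proof.
have ex v : exists a : W -> R, v \in vertices L ->
    [/\ forall w, w \in B -> 0 <= a w, \sum_(w in B) a w = 1
      & p v = \sum_(w in B) a w *: p w].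
  case: (boolP (v \in vertices L)) => [/vertex_coordinates[a ?]|]; first by exists a.
  by exists (fun=> 0).
by have [a aP] := choice ex; exists a.
Qed.

Lemma combination_coordinates s (g : W -> R) (a : W -> W -> R) :
  s \subset vertices L ->
  (forall v, v \in vertices L -> [/\ forall w, w \in B -> 0 <= a v w,
     \sum_(w in B) a v w = 1 & p v = \sum_(w in B) a v w *: p w]) ->
  \sum_(w in B) \sum_(v in s) g v * a v w = \sum_(v in s) g v /\
  \sum_(v in s) g v *: p v = \sum_(w in B) (\sum_(v in s) g v * a v w) *: p w.
Proof.
move=> /fintype.subsetP sV aP; split.
  rewrite exchange_big /=; apply: eq_bigr => v /sV/aP[_ a1 _].
  by rewrite -mulr_sumr a1 mulr1.
under [RHS]eq_bigr do rewrite scaler_suml.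
rewrite exchange_big /=; apply: eq_bigr => v /sV/aP[_ _ {1}->].
by rewrite scaler_sumr; apply: eq_bigr => w _; rewrite scalerA.
Qed.

(** A vertex of [s] outside [B] has only positive coordinates in the frame, so the barycenter of [s]
    is an interior point. *)
Lemma interior_germ s b : s \in L -> ~~ (s \subset B) ->
  germ p B (bary s) (signed_direction b).
Proof.
move=> sL /subsetPn[v0 v0s v0B].
have sV := face_vertices sL.
have s0 : s != finset.set0 by apply/finset.set0Pn; exists v0.
have s_gt0 : 0 < (#|s|%:R^-1 : R) by rewrite invr_gt0 ltr0n card_gt0.
have [a aP] := exists_vertex_coordinates.
have [g1 gE] := combination_coordinates (fun=> #|s|%:R^-1) sV aP.
have [_ _ iB] := frame_nondegenerate.
have a_ge0 v w : v \in s -> w \in B -> 0 <= #|s|%:R^-1 * a v w.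
  move=> /(fintype.subsetP sV)/aP[a0 _ _] /a0 ?.
  by rewrite mulr_ge0 // ltW.
apply/(germP iB (signed_weights b frame_nondegenerate) _ _ gE).
- by move=> w wB; apply: sumr_ge0 => v /a_ge0; apply.
- by rewrite g1 sum_bary_coef.
move=> w wB /eqP; rewrite psumr_eq0 => [/allP/(_ v0)|v /a_ge0]; last exact.
rewrite mem_index_enum v0s mulf_eq0 gt_eqF //= => /(_ isT)/eqP a00.
have [a0 a1 aE] := aP _ (fintype.subsetP sV _ v0s).
have := zero_coordinate_frame (fintype.subsetP sV _ v0s) wB a0 a1 aE a00.
by rewrite inE (negPf v0B) andbF.
Qed.

(** Some 2-face [t] contains the midpoint of [e]. Only vertices of [t] on the line of [e] can
    contribute to it, and these are ends of [e]; hence both ends belong to [t]. *)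
Lemma boundary_edge e : e \subset B -> #|e| = 2%N -> e \in L.
Proof.
move=> eB e2; have ndB := frame_nondegenerate; have [BV B3 iB] := ndB.
have e0 : e != finset.set0 by rewrite -card_gt0 e2.
have [b ent] : exists b, enters B e b.
  have := sum_enters_edge ndB eB e2; rewrite big_bool.
  case E1: (enters _ _ true); first by exists true.
  by case E2: (enters _ _ false); first by exists false.
have [t [tL t3 _ [g [g0 g1 gE]]]] := germ_face ((germ_bary b ndB eB e0).2 ent).
(* [x] is the corner opposite [e]: the midpoint has coordinate 0 there. *)
have /eqP/cards1P[x xE] : #|B :\: e|%SET = 1%N by rewrite cardsDS // B3 e2.
have /setDP[xB xe] : x \in (B :\: e)%SET by rewrite xE inE.
have Bxe : (B :\ x)%SET = e.
  by rewrite -xE finset.setDDr finset.setDv finset.set0U; apply/finset.setIidPr.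
suff et : e \subset t by apply: LC.2 et.
apply: bary_face => //; first exact: affinely_independent_sub iB.
have tV := face_vertices tL.
have [a aP] := exists_vertex_coordinates.
have [c1 cE] := combination_coordinates g tV aP.
have := @affinely_independent_eq _ _ p B (fun w => \sum_(v in t) g v * a v w)
  (fun w => if w \in e then #|e|%:R^-1 else 0) iB.
rewrite c1 g1 sum_if_subset // sum_bary_coef // => /(_ erefl).
rewrite -cE -gE => /(_ _ x xB); rewrite (negPf xe) => H.
have /eqP : \sum_(v in t) g v * a v x = 0.
  apply: H; rewrite /bary -(sum_if_subset _ eB); apply: eq_bigr => w _.
  by case: ifP => //; rewrite scale0r.
rewrite psumr_eq0 => [/allP gz|v vt]; last first.
  have [a0 _ _] := aP _ (fintype.subsetP tV _ vt); by rewrite mulr_ge0 ?g0 ?a0.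
have supp v : v \in t -> v \notin e -> g v = 0.
  move=> vt ve; have vV := fintype.subsetP tV _ vt.
  have := gz v; rewrite mem_index_enum vt mulf_eq0 => /(_ isT)/orP[/eqP //|/eqP ax].
  have [a0 a1 aE] := aP _ vV.
  by have := zero_coordinate_frame vV xB a0 a1 aE ax; rewrite Bxe (negPf ve).
exists g; split=> [w|| ].
- by rewrite inE => /andP[_ /g0].
- rewrite -g1 -(sum_if_subset _ (finset.subsetIr e t)); apply: eq_bigr => w wt.
  by rewrite inE wt andbT; case: ifPn => // /(supp _ wt).
- rewrite gE -(sum_if_subset _ (finset.subsetIr e t)); apply: eq_bigr => w wt.
  by rewrite inE wt andbT; case: ifPn => // /(supp _ wt) ->; rewrite scale0r.
Qed.

Definition interior_vertices := (vertices L :\: B)%SET.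

(** Each 2-face on [e] is entered from its midpoint for exactly one sign. Both signs stay in the
    frame if [e] is interior, one if [e] is a side. *)
Lemma edge_degree e : e \in L -> #|e| = 2%N ->
  (\sum_(t in triangles) (e \subset t) = 2 - (e \subset B))%N.
Proof.
have ndB := frame_nondegenerate; move=> eL e2.
have e0 : e != finset.set0 by rewrite -card_gt0 e2.
transitivity (\sum_(b : bool) `[< germ p B (bary e) (signed_direction b) >])%N.
  under [RHS]eq_bigr do rewrite -sum_enters //.
  rewrite exchange_big /= [RHS]big_mkcondr /=.
  apply: eq_bigr => t /triangleP[tL t3]; case: ifP => // et.
  by rewrite sum_enters_edge //; exact: triangle_nondegenerate.
case: (boolP (e \subset B)) => eB.
  rewrite subn1 -[RHS](sum_enters_edge frame_nondegenerate eB e2); apply: eq_bigr => b _.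
  by congr (nat_of_bool _); apply/asboolP/idP => ?; apply/(germ_bary b ndB eB e0).
by rewrite big_bool !asboolT //; exact: interior_germ.
Qed.

(** Each 2-face is entered from one vertex with one sign. An interior vertex accounts for both
    signs; the three corners together account for one, by the same fact applied to [B]. *)
Lemma card_triangles : #|triangles| = (2 * #|interior_vertices|).+1.
Proof.
have ndB := frame_nondegenerate; have [BV _ _] := ndB.
have v0 v : [set v]%SET != finset.set0 :> {set W}.
  by apply/finset.set0Pn; exists v; rewrite inE.
transitivity (\sum_(v in vertices L) \sum_(b : bool)
    `[< germ p B (bary [set v]) (signed_direction b) >])%N.
  have vE v : v \in vertices L -> [set v]%SET \in L by rewrite inE.
  transitivity (\sum_(v in vertices L) \sum_(b : bool)
      \sum_(t in triangles | [set v] \subset t) enters t [set v] b)%N; last first.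
    by apply: eq_bigr => v vV; apply: eq_bigr => b _; rewrite sum_enters ?vE.
  under eq_bigr do rewrite exchange_big /= big_mkcondr /=.
  rewrite exchange_big /= -sum1_card; apply: eq_bigr => t /triangleP[tL t3].
  rewrite -(sum_enters_vertex (triangle_nondegenerate tL t3)).
  rewrite -(sum_if_subset _ (face_vertices tL)); apply: eq_bigr => v _.
  by rewrite finset.sub1set.
rewrite (big_setID B) /= (finset.setIidPr BV) -/interior_vertices -add1n.
congr (_ + _)%N.
  rewrite -[RHS](sum_enters_vertex ndB); apply: eq_bigr => v vB; apply: eq_bigr => b _.
  have sB : [set v]%SET \subset B by rewrite finset.sub1set.
  by congr (nat_of_bool _); apply/asboolP/idP => ?; apply/(germ_bary b ndB sB (v0 v)).
rewrite mulnC -sum_nat_const; apply: eq_bigr => v /setDP[vV vB].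
by rewrite big_bool !asboolT //; apply: interior_germ;
  rewrite ?finset.sub1set //; move: vV; rewrite inE.
Qed.

End Triangulation.

(** * Face counts *)

Section Counting.
Variables (W : finType) (L : {set {set W}}) (B : {set W}).
Implicit Types (s t e : {set W}).

Definition nclass (j k : nat) := #|[set s in L | (#|s :&: B| == j) && (#|s :\: B| == k)]%SET|.

Hypotheses (LC : simplicial_complex L) (B3 : #|B| = 3%N) (BL : B \notin L).
Hypothesis card_face : forall s, s \in L -> (#|s| <= 3)%N.
Hypothesis edge_in : forall e, e \subset B -> #|e| = 2%N -> e \in L.
Hypothesis edge_deg : forall e, e \in L -> #|e| = 2%N ->
  (\sum_(t in triangles L) (e \subset t) = 2 - (e \subset B))%N.
Hypothesis card_tri : #|triangles L| = (2 * #|interior_vertices L B|).+1.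

Lemma card_class s : (#|s :&: B| + #|s :\: B| = #|s|)%N.
Proof. exact: cardsID. Qed.

Lemma subset_class s : (s \subset B) = (#|s :\: B| == 0%N).
Proof. by rewrite cards_eq0 finset.setD_eq0. Qed.

Lemma nclass_interior_vertices : nclass 0 1 = #|interior_vertices L B|.
Proof.
rewrite /nclass -(card_imset _ (@set1_inj W)); apply: eq_card => s.
apply/idP/imsetP => [|[v]]; rewrite !inE.
  case/and3P=> sL /eqP c0 /eqP c1.
  have /eqP/cards1P[v vE] : #|s| = 1%N by rewrite -card_class c0 c1.
  exists v => //; rewrite !inE -vE sL andbT; apply/negP => vB.
  have : v \in (s :&: B)%SET by rewrite vE !inE eqxx.
  by move/eqP: c0; rewrite cards_eq0 => /eqP ->; rewrite inE.
move=> /andP[vB vL] ->; rewrite vL /=; apply/andP; split.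
  by rewrite cards_eq0 finset.setI_eq0 disjoints1.
rewrite (_ : _ :\: _ = [set v])%SET ?cards1 //.
by apply/finset.setDidPl; rewrite disjoints1.
Qed.

Lemma triangle_class t : t \in triangles L ->
  [/\ (#|t :&: B| < 3)%N & #|t :\: B| = (3 - #|t :&: B|)%N].
Proof.
move=> /triangleP[tL t3]; have := card_class t; rewrite t3 => c; split; last by lia.
rewrite ltn_neqAle; apply/andP; split; last by lia.
apply: contraNneq BL => k3; suff <- : t = B by [].
apply/eqP; rewrite eqEcard B3 t3 leqnn andbT subset_class; apply/eqP; lia.
Qed.

(** An edge of [t] is [t] minus a vertex: dropping a corner lowers the number of corners by one,
    dropping another vertex keeps it. *)
Lemma triangle_edges t j : t \in triangles L ->
  (\sum_(e in L | (#|e| == 2) && (#|e :&: B| == j)) (e \subset t)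
   = #|t :&: B| * (#|t :&: B| == j.+1) + (3 - #|t :&: B|) * (#|t :&: B| == j))%N.
Proof.
move=> tT; have /triangleP[tL t3] := tT; have [_ tD] := triangle_class tT.
transitivity (\sum_(v in t) (#|(t :\ v) :&: B| == j))%N.
  rewrite -big_mkcondr /= sum1dep_card -big_mkcondr /= sum1dep_card.
  have inj : {in [set v | (v \in t) && (#|(t :\ v) :&: B| == j)]%SET &,
      injective (fun v => t :\ v)%SET}.
    move=> u v; rewrite !inE => /andP[ut _] /andP[vt _] /setP/(_ u).
    by rewrite !inE eqxx ut; case: eqP.
  rewrite -(card_in_imset inj); apply: eq_card => e.
  apply/idP/imsetP => [|[v]]; rewrite !inE.
    move=> /andP[/and3P[eL /eqP e2 ej] et].
    have /eqP/cards1P[v vE] : #|t :\: e|%SET = 1%N by rewrite cardsDS // t3 e2.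
    have eE : e = (t :\ v)%SET.
      by rewrite -vE finset.setDDr finset.setDv finset.set0U; apply/esym/finset.setIidPr.
    have /setDP[vt _] : v \in (t :\: e)%SET by rewrite vE inE.
    by exists v => //; rewrite inE vt -eE.
  move=> /andP[vt vj] ->; rewrite vj finset.subD1set andbT.
  rewrite (LC.2 _ _ tL (finset.subD1set _ _)) /=.
  by move: t3; rewrite (cardsD1 v) vt add1n => -[->].
rewrite (big_setID B) /= -tD; congr (_ + _)%N.
  rewrite -sum_nat_const; apply: eq_bigr => v vtB; congr nat_of_bool.
  by rewrite finset.setIDAC [in RHS](cardsD1 v) vtB.
rewrite -sum_nat_const; apply: eq_bigr => v /setDP[_ vB]; congr nat_of_bool.
rewrite finset.setIDAC; congr (#|pred_of_set _| == j); apply/finset.setDidPl.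
by rewrite disjoint_sym disjoints1 inE (negPf vB) andbF.
Qed.

Lemma nclass_edge (j : nat) : (\sum_(e in L | (#|e| == 2) && (#|e :&: B| == j)) 1 = 
  if (j <= 2)%N then nclass j (2 - j) else 0)%N.
Proof.
rewrite sum1dep_card; case: leqP => j2; last first.
  apply: eq_card0 => e; apply/negP; rewrite !inE => /and3P[_ /eqP e2 /eqP ej].
  by move: j2; rewrite -ej -e2 ltnNge subset_leq_card // finset.subsetIl.
apply: eq_card => e; rewrite !inE; case: (e \in L) => //=.
have c := card_class e; apply/andP/andP => -[/eqP h1 /eqP h2]; split; apply/eqP; lia.
Qed.

Lemma nclass_triangle j : (j < 3)%N ->
  (\sum_(t in triangles L) (#|t :&: B| == j) = nclass j (3 - j))%N.
Proof.
move=> j3; rewrite -big_mkcondr /= sum1dep_card; apply: eq_card => t; rewrite !inE.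
case: (t \in L) => //=; have := card_class t.
by move=> c; apply/andP/andP => -[/eqP h1 /eqP h2]; split; apply/eqP; lia.
Qed.

(** Incidences between edges with [j] corners and 2-faces, counted both ways; an edge is a side of
    the frame exactly when [j = 2]. *)
Lemma double_count (j : nat) :
  (\sum_(e in L | (#|e| == 2) && (#|e :&: B| == j)) (2 - (j == 2))
   = \sum_(t in triangles L) (#|t :&: B| * (#|t :&: B| == j.+1)
                              + (3 - #|t :&: B|) * (#|t :&: B| == j)))%N.
Proof.
transitivity (\sum_(t in triangles L)
    \sum_(e in L | (#|e| == 2) && (#|e :&: B| == j)) (e \subset t))%N.
  rewrite exchange_big /=; apply: eq_bigr => e /and3P[eL /eqP e2 /eqP ej].
  rewrite edge_deg // subset_class; congr (2 - nat_of_bool _)%N.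
  by have c := card_class e; apply/eqP/eqP; lia.
by apply: eq_bigr => t tT; rewrite triangle_edges.
Qed.

(** The double counts for [j = 0, 1, 2], the total number of 2-faces and the three sides of the
    frame form a linear system with these consequences. *)
Lemma class_counts : [/\ nclass 2 1 = 3%N, (nclass 1 2 + 3 = nclass 1 1)%N,
  (nclass 0 3 + nclass 1 1 = 2 * nclass 0 1 + 1)%N
  & (nclass 0 2 + nclass 1 1 = 3 * nclass 0 1)%N].
Proof.
have const (j n : nat) : (\sum_(e in L | (#|e| == 2) && (#|e :&: B| == j)) n
    = n * if (j <= 2)%N then nclass j (2 - j) else 0)%N.
  by rewrite -nclass_edge big_distrr /=; apply: eq_bigr => *; rewrite muln1.
have tri j n : (j < 3)%N ->
    (\sum_(t in triangles L) n * (#|t :&: B| == j) = n * nclass j (3 - j))%N.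
  by move=> j3; rewrite -nclass_triangle // big_distrr.
have norm j : (\sum_(t in triangles L) (#|t :&: B| * (#|t :&: B| == j.+1)
      + (3 - #|t :&: B|) * (#|t :&: B| == j))
    = (if (j < 2)%N then j.+1 * nclass j.+1 (2 - j) else 0)
      + (if (j < 3)%N then (3 - j) * nclass j (3 - j) else 0))%N.
  rewrite big_split; congr (_ + _)%N.
    transitivity (\sum_(t in triangles L) j.+1 * (#|t :&: B| == j.+1))%N.
      by apply: eq_bigr => t _; case: eqP => [->|_]; rewrite ?muln0.
    case: ltnP => j2; first by rewrite tri.
    rewrite big1 // => t /triangle_class[k3 _].
    by case: eqP => [kj|]; rewrite ?muln0 //; lia.
  transitivity (\sum_(t in triangles L) (3 - j) * (#|t :&: B| == j))%N.
    by apply: eq_bigr => t _; case: eqP => [->|_]; rewrite ?muln0.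
  case: ltnP => j2; first by rewrite tri.
  rewrite big1 // => t /triangle_class[k3 _].
  by case: eqP => [kj|]; rewrite ?muln0 //; lia.
have := double_count 0%N; have := double_count 1%N; have := double_count 2%N.
rewrite !const !norm /= !subn0 !subn1 !mul1n ?subnn /= => c2 c1 c0.
have b3 : nclass 2 0 = 3%N.
  transitivity 'C(3, 2) => //; rewrite -B3 -cards_draws; apply: eq_card => e.
  rewrite !inE; have c := card_class e; apply/and3P/andP.
    by case=> _ /eqP h2 /eqP h0; rewrite subset_class h0; split=> //; apply/eqP; lia.
  move=> [eB /eqP e2]; have := eB; rewrite subset_class => /eqP h0.
  by rewrite edge_in // h0; split=> //; apply/eqP; lia.
have tot : #|triangles L| = (nclass 0 3 + nclass 1 2 + nclass 2 1)%N.
  rewrite -(nclass_triangle (isT : 0 < 3)%N) -(nclass_triangle (isT : 1 < 3)%N).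
  rewrite -(nclass_triangle (isT : 2 < 3)%N) -!big_split -sum1_card /=.
  by apply: eq_bigr => t /triangle_class[]; case: #|_| => [|[|[|]]].
move: tot; rewrite card_tri -nclass_interior_vertices.
have {}c2 : nclass 2 0 = nclass 2 1 := c2.
split; lia.
Qed.

Lemma sum_inner (M : nmodType) (F : nat -> nat -> M) :
  \sum_(s in L | ~~ (s \proper B)) F #|s :&: B| #|s :\: B|
  = F 0 1 *+ nclass 0 1 + F 1 1 *+ nclass 1 1 + F 2 1 *+ nclass 2 1
    + F 0 2 *+ nclass 0 2 + F 1 2 *+ nclass 1 2 + F 0 3 *+ nclass 0 3.
Proof.
have cls j k : F j k *+ nclass j k
    = \sum_(s in L) if (#|s :&: B| == j) && (#|s :\: B| == k) then F j k else 0.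
  by rewrite -big_mkcondr sumr_const; congr (_ *+ _); apply: eq_card => s; rewrite !inE.
rewrite !cls -!big_split big_mkcondr /=; apply: eq_bigr => s sL.
(* As [B] is not a face, a face inside [B] is properly inside; at most three vertices then leave six
   classes. *)
have -> : (s \proper B) = (#|s :\: B| == 0%N).
  rewrite -subset_class finset.properEneq; case: (boolP (s \subset B)); rewrite ?andbF // andbT.
  by move=> _; apply: contraNneq BL => <-.
have := card_face sL; rewrite -card_class.
case: #|s :&: B| => [|[|[|[|j]]]]; case: #|s :\: B| => [|[|[|[|k]]]] //= _;
  by rewrite ?(addr0, add0r).
Qed.

End Counting.

(** * Subdividing one triangle of a complex *)

Definition half_shift (R : realType) : {poly R} := (2^-1)%:P * ('X - 1).

(** A sum over faces can be followed through the replacement of some of them. *)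
Lemma FpolyE (R : realType) (V : finType) (K : {set {set V}}) :
  Fpoly R K = \sum_(s in K) half_shift R ^+ #|s|.
Proof.
rewrite [RHS](partition_big (fun s : {set V} => inord #|s| : 'I_(rank K).+1) xpredT) //=.
apply: eq_bigr => j _; rewrite scaler_nat.
rewrite -/(half_shift R) /nfaces -sumr_const; symmetry.
transitivity (\sum_(s in K | inord #|s| == j) half_shift R ^+ j).
  apply: eq_bigr => s /andP[sK /eqP <-]; rewrite inordK // ltnS.
  exact: leq_bigmax_cond.
apply: eq_bigl => s; rewrite !inE; case sK: (s \in K) => //=.
have lt : (#|s| < (rank K).+1)%N by rewrite ltnS; exact: leq_bigmax_cond.
by apply/eqP/eqP => [<-|sj]; [rewrite inordK|apply: val_inj; rewrite /= inordK].
Qed.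

Section ReplaceFace.
Variables (W V : finType) (L : {set {set W}}) (B : {set W}).
Variables (K : {set {set V}}) (s : {set V}) (psi : W -> V).
Hypotheses (LC : simplicial_complex L) (KC : simplicial_complex K).
Hypothesis psi_inj : {in vertices L &, injective psi}.
Hypothesis psiB : psi @: B = s.
Hypothesis BV : B \subset vertices L.
Hypothesis psi_new : forall w, w \in vertices L -> w \notin B ->
  psi w \notin vertices K.

Lemma face_vertex (U : finType) (M : {set {set U}}) (r : {set U}) v :
  simplicial_complex M -> r \in M -> v \in r -> v \in vertices M.
Proof. by move=> MC rM vr; rewrite inE; apply: MC.2 rM _; rewrite sub1set. Qed.

Lemma starE : [set s :|: t | t in link K s] = [set r in K | s \subset r].
Proof.
apply/setP => r; apply/imsetP/idP => [[t]|].
  by rewrite !inE => /and3P[_ _ stK] ->; rewrite stK subsetUl.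
rewrite inE => /andP[rK sr]; exists (r :\: s).
  rewrite inE (KC.2 _ _ rK (subsetDl _ _)) /= disjoint_sym disjoints_subset.
  by rewrite subsetDr /= -{1}(setIidPr sr) setID.
by rewrite -{1}(setIidPr sr) setID.
Qed.

Lemma linkE : link K s = [set r :\: s | r in [set r in K | s \subset r]].
Proof.
rewrite -starE -imset_comp -[LHS]imset_id; apply: eq_in_imset => t /=.
rewrite inE => /and3P[_ dst _].
by rewrite setDUl setDv set0U; apply/esym/setDidPl; rewrite disjoint_sym.
Qed.

Lemma in_replace_face r : reflect
  ((r \in K /\ ~~ (s \subset r)) \/
   exists s' t, [/\ s' \in L, t \in link K s & r = psi @: s' :|: t])
  (r \in replace_face L K s psi).
Proof.
rewrite !inE starE inE andbC.
apply: (iffP orP) => -[|].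
- by case rK: (r \in K); rewrite //= ?andbF // => sr; left.
- by case/imset2P => s' t sL tl ->; right; exists s', t.
- by case=> rK sr; left; rewrite rK sr.
- by case=> s' [t [sL tl ->]]; right; apply/imset2P; exists s' t.
Qed.

Lemma replace_face_complex : simplicial_complex (replace_face L K s psi).
Proof.
have [K0 KS] := KC; split.
  (* If [s] is empty, the empty face is removed but comes back from the empty face of [L]. *)
  apply/in_replace_face; case: (boolP (s \subset set0)) => s0; last by left.
  right; exists set0, set0; rewrite imset0 setU0; split=> //; first by case: LC.
  move: s0; rewrite subset0 => /eqP ->.
  by rewrite inE setU0 K0 disjoints_subset sub0set.
move=> r r' /in_replace_face[[rK sr] r'r|[s' [t [sL tl ->]]] r'r].
  apply/in_replace_face; left; split; first exact: KS r'r.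
  by apply: contraNN sr => sr'; exact: subset_trans sr' r'r.
apply/in_replace_face; right; exists (s' :&: psi @^-1: r'), (t :&: r'); split.
- by apply: LC.2 sL _; exact: subsetIl.
- move: tl; rewrite !inE => /and3P[tK dst stK].
  rewrite (KS _ _ tK (subsetIl _ _)) (KS _ _ stK) ?setUS ?subsetIl // andbT /=.
  by apply: disjointWr dst; exact: subsetIl.
apply/setP => v; rewrite !inE; apply/idP/orP => [vr'|[/imsetP[w]|/andP[]//]].
  have := subsetP r'r _ vr'; rewrite inE vr' andbT => /orP[/imsetP[w ws ve]|]; last by right.
  by left; rewrite ve imset_f // !inE ws -ve.
by rewrite !inE => /andP[_ wr] ->.
Qed.

Lemma replace_face_vertices v : v \in vertices (replace_face L K s psi) ->
  v \in vertices K \/ exists2 w, w \in vertices L & v = psi w.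
Proof.
rewrite inE => /in_replace_face[[vK _]|[s' [t [sL tl vE]]]].
  by left; rewrite inE.
have : v \in psi @: s' :|: t by rewrite -vE inE.
rewrite inE => /orP[/imsetP[w ws ->]|vt]; [right|left].
  by exists w => //; exact: face_vertex ws.
by move: tl; rewrite inE => /andP[tK _]; exact: face_vertex vt.
Qed.

Lemma link_psi_disjoint t w : t \in link K s -> w \in vertices L -> psi w \notin t.
Proof.
rewrite inE => /and3P[tK dst _] wV; apply/negP => wt.
case: (boolP (w \in B)) => wB.
  have ws : psi w \in s by rewrite -psiB imset_f.
  by rewrite (disjointFr dst ws) in wt.
by have := psi_new wV wB; rewrite (face_vertex KC tK wt).
Qed.

(** The copy of [L] shares no vertex with a face of the link, so both parts can be recovered from
    the union. *)
Lemma link_face_inj : {in setX L (link K s) &,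
  injective (fun x : {set W} * {set V} => psi @: x.1 :|: x.2)}.
Proof.
move=> [s1 t1] [s2 t2] /setXP[/= s1L t1l] /setXP[/= s2L t2l] e.
have sub s1' s2' t1' t2' : s1' \in L -> s2' \in L -> t1' \in link K s ->
    t2' \in link K s -> psi @: s1' :|: t1' = psi @: s2' :|: t2' ->
    (s1' \subset s2') && (t1' \subset t2').
  move=> s1L' s2L' t1l' t2l' e'; apply/andP; split; apply/subsetP => x xi.
    have xV := face_vertex LC s1L' xi.
    have : psi x \in psi @: s2' :|: t2' by rewrite -e' inE imset_f.
    rewrite inE (negPf (link_psi_disjoint t2l' xV)) orbF => /imsetP[y ys].
    by move=> /psi_inj -> //; exact: face_vertex ys.
  have : x \in psi @: s2' :|: t2' by rewrite -e' inE xi orbT.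
  rewrite inE => /orP[/imsetP[y ys xe]|//].
  by have := link_psi_disjoint t1l' (face_vertex LC s2L' ys); rewrite -xe xi.
have /andP[a1 a2] := sub _ _ _ _ s1L s2L t1l t2l e.
have /andP[b1 b2] := sub _ _ _ _ s2L s1L t2l t1l (esym e).
by congr (_, _); apply/eqP; rewrite eqEsubset ?a1 ?a2.
Qed.

(** The change is local: each face [r] above [s] is exchanged for the joins of [r :\: s] with the
    faces of [L] not properly inside [B]. *)
Lemma sum_replace_face (M : nmodType) (G : {set V} -> M) :
  \sum_(r in replace_face L K s psi) G r =
  \sum_(r in K) if s \subset r then
    \sum_(s' in L | ~~ (s' \proper B)) G (psi @: s' :|: (r :\: s)) else G r.
Proof.
pose inner := [set s' in L | ~~ (s' \proper B)].
pose glue (x : {set W} * {set V}) := psi @: x.1 :|: x.2.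
have -> : replace_face L K s psi
    = [set r in K | ~~ (s \subset r)] :|: glue @: setX inner (link K s).
  apply/setP => r; rewrite [RHS]inE; apply/in_replace_face/orP; last first.
    case=> [|/imsetP[[s' t]]]; first by rewrite inE => /andP[]; left.
    by rewrite !inE /= => /andP[/andP[sL _] tl] ->; right; exists s', t; rewrite inE.
  case=> [[rK sr]|[s' [t [sL tl ->]]]]; first by left; rewrite inE rK.
  (* For [s'] properly inside [B], the glued face is an old face missing a vertex of [s], so it was
     never removed. *)
  case: (boolP (s' \proper B)) => sB; last first.
    by right; apply/imsetP; exists (s', t); rewrite // inE /= tl inE sL sB.
  left; move: (tl); rewrite !inE => /and3P[tK dst stK]; apply/andP; split.
    by apply: KC.2 stK _; rewrite setSU // -psiB imsetS // proper_sub.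
  apply/negP => sub; have /properP[_ [w wB ws]] := sB.
  have := subsetP sub (psi w); rewrite -psiB imset_f // => /(_ isT).
  have wV := subsetP BV _ wB.
  rewrite inE (negPf (link_psi_disjoint tl wV)) orbF => /imsetP[y ys].
  by move=> /psi_inj yw; move: ws; rewrite yw ?ys //; exact: face_vertex ys.
(* Disjointness: a glued face lying in [K] has no new vertex, so [s' = B] and the face contains
   [s]. *)
rewrite (eq_bigl _ _ (fun r => in_setU r _ _)) bigU /=; last first.
  rewrite -setI_eq0; apply/eqP/setP => r; rewrite !inE; apply/negP.
  move=> /andP[/andP[rK sr] /imsetP[[s' t]]]; rewrite inE /= => /andP[].
  rewrite inE => /andP[sL sB] tl re.
  have sE : s' \subset B.
    apply/subsetP => w ws; have wV := face_vertex LC sL ws.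
    apply: contraT => /(psi_new wV)/negP; case; apply: (face_vertex KC rK).
    by rewrite re /glue inE imset_f.
  move: sB; rewrite properEneq sE andbT negbK => /eqP sE'.
  by move: sr; rewrite re /glue /= sE' psiB subsetUl.
rewrite [RHS](bigID (fun r : {set V} => s \subset r)) /= [RHS]addrC; congr (_ + _).
  by apply: eq_big => r; rewrite inE // => /andP[_ /negPf ->].
rewrite big_imset /=; last first.
  apply: sub_in2 link_face_inj => -[s' t]; rewrite !in_setX inE.
  by move=> /andP[/andP[-> _] ->].
transitivity (\sum_(t in link K s) \sum_(s' in inner) G (psi @: s' :|: t)).
  rewrite exchange_big pair_big_dep /=; apply: eq_bigl => -[s' t].
  by rewrite inE.
rewrite linkE big_imset /=; last first.
  move=> r r'; rewrite !inE => /andP[_ sr] /andP[_ sr'] e.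
  by rewrite -(setID r s) -(setID r' s) e (setIidPr sr) (setIidPr sr').
apply: eq_big => r; rewrite inE // => /andP[_ ->].
by apply: eq_bigl => s'; rewrite inE.
Qed.

End ReplaceFace.

(** * Subdividing a simplex *)

Lemma exists_bijection_on (T U : finType) (A : {set T}) (C : {set U}) :
  #|A| = #|C| -> C != set0 ->
  exists f : T -> U, {in A &, injective f} /\ f @: A = C.
Proof.
move=> eAC /set0Pn[u0 _].
pose f w := nth u0 (enum C) (index w (enum A)).
have idx w : w \in A -> (index w (enum A) < size (enum C))%N.
  by move=> wA; rewrite -cardE -eAC cardE index_mem mem_enum.
have finj : {in A &, injective f}.
  move=> v w vA wA /eqP; rewrite nth_uniq ?idx ?enum_uniq // => /eqP.
  by move/(congr1 (nth v (enum A))); rewrite !nth_index ?mem_enum.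
exists f; split=> //; apply/eqP; rewrite eqEcard card_in_imset // eAC leqnn andbT.
apply/subsetP => _ /imsetP[w wA ->].
by rewrite -mem_enum mem_nth // idx.
Qed.

Lemma card_disjointU (T : finType) (A C : {set T}) :
  [disjoint A & C] -> #|A :|: C| = (#|A| + #|C|)%N.
Proof. by move=> dAC; rewrite cardsU disjoint_setI0 // cards0 subn0. Qed.

Section Subdivide.
Variables (W U : finType) (L : {set {set W}}) (B : {set W}).
Hypotheses (LC : simplicial_complex L) (B3 : #|B| = 3%N).
Hypotheses (BV : B \subset vertices L) (BL : B \notin L).
Variables (R : comNzRingType) (t : R) (P : nat -> R).
Hypothesis P_small : forall k, (k < 3)%N -> P k = t ^+ k.
Hypothesis P_rec : forall k, P k.+3 =
  \sum_(s in L | ~~ (s \proper B)) P (k + #|s :&: B|)%N * t ^+ #|s :\: B|.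

(* A new vertex is tagged by the triangle whose subdivision creates it. *)
Local Notation V := (U + {set U} * W)%type.
Let old (s : {set U}) : {set V} := [set inl u | u in s].
Let O : {set V} := old [set: U].

(** The anticipated final contribution of [r]: its old vertices span a simplex still to be
    subdivided, while each new vertex already counts as [t]. *)
Let weight (r : {set V}) : R := P #|r :&: O| * t ^+ #|r :\: O|.

Let mem_old (u : U) s : ((inl u : V) \in old s) = (u \in s).
Proof. by apply: mem_imset => x y []. Qed.

Let old_inj : injective old.
Proof. by apply: imset_inj => x y []. Qed.

Let card_old s : #|old s| = #|s|.
Proof. by apply: card_imset => x y []. Qed.

Let old_sub s : old s \subset O.
Proof. by apply/subsetP => _ /imsetP[u us ->]; rewrite mem_old. Qed.

Let old_preim (r : {set V}) : r \subset O -> exists s, r = old s.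
Proof.
move=> rO; exists [set u | inl u \in r]; apply/setP => v; apply/idP/imsetP.
  move=> vr; have /imsetP[u _ ve] := subsetP rO _ vr.
  by exists u => //; rewrite inE -ve.
by move=> [u]; rewrite inE => ? ->.
Qed.

Lemma exists_new_vertices (s : {set U}) : #|s| = 3%N -> exists psi : W -> V,
  [/\ injective psi, psi @: B = old s & forall w, w \notin B -> psi w = inr (s, w)].
Proof.
move=> s3; have [||f [finj fB]] := @exists_bijection_on W U B s.
- by rewrite B3.
- by rewrite -card_gt0 s3.
exists (fun w => if w \in B then inl (f w) else inr (s, w)); split.
- move=> v w; case: ifP => vB; case: ifP => wB // [].
    exact: finj.
  by [].
- rewrite -fB /old -imset_comp; apply: eq_in_imset => w wB /=.
  by rewrite wB.
- by move=> w /negPf ->.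
Qed.

(** Subdividing [s] preserves the total weight: this is [P_rec] with [k] the number of old vertices
    of [r] outside [s]. *)
Lemma sum_weight_star (K : {set {set V}}) (s : {set U}) (psi : W -> V) r :
  simplicial_complex K -> injective psi -> psi @: B = old s ->
  (forall w, w \notin B -> psi w = inr (s, w)) ->
  (forall w, inr (s, w) \notin vertices K) -> #|s| = 3%N ->
  r \in K -> old s \subset r ->
  \sum_(s' in L | ~~ (s' \proper B)) weight (psi @: s' :|: (r :\: old s))
  = weight r.
Proof.
move=> KC pinj pB pnew fresh s3 rK sr.
have cO : #|r :&: O| = (#|(r :\: old s) :&: O|).+3.
  rewrite -(cardsID (old s) (r :&: O)) -setIA (setIidPr (old_sub s)) (setIidPr sr).
  by rewrite card_old s3 setIDAC.
rewrite {2}/weight cO P_rec mulr_suml; apply: eq_bigr => s' /andP[s'L _].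
have new w : w \notin B -> psi w \notin r.
  move=> wB; rewrite (pnew _ wB); apply/negP => wr.
  by have := fresh w; rewrite (face_vertex KC rK wr).
have psiO w : (psi w \in O) = (w \in B).
  case: (boolP (w \in B)) => wB; last by apply/imsetP => -[u _]; rewrite pnew.
  by apply: (subsetP (old_sub s)); rewrite -pB imset_f.
have preB (A : {set W}) : A \subset B -> psi @: A \subset old s.
  by move=> AB; rewrite -pB imsetS.
rewrite /weight -mulrA -exprD; congr (P _ * t ^+ _).
  have -> : (psi @: s' :|: r :\: old s) :&: O
      = psi @: (s' :&: B) :|: (r :\: old s) :&: O.
    rewrite setIUl; congr (_ :|: _); apply/setP => v; rewrite inE.
    apply/andP/imsetP => [[/imsetP[w ws ->]]|[w]].
      by rewrite psiO => wB; exists w => //; rewrite inE ws.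
    by rewrite inE => /andP[ws wB] ->; rewrite imset_f // psiO.
  rewrite card_disjointU ?card_imset 1?addnC //.
  apply: disjointWl (preB _ (subsetIr _ _)) _.
  rewrite -setI_eq0; apply/eqP/setP => v; rewrite !in_setI in_setD in_set0.
  by case: (v \in old s).
have -> : (psi @: s' :|: r :\: old s) :\: O = psi @: (s' :\: B) :|: r :\: O.
  rewrite setDUl setDDl (setUidPr (old_sub s)); congr (_ :|: _).
  apply/setP => v; rewrite inE.
  apply/andP/imsetP => [[+ /imsetP[w ws ve]]|[w]].
    by rewrite ve psiO => wB; exists w => //; rewrite inE ws wB.
  by rewrite inE => /andP[ws wB] ->; rewrite imset_f // psiO.
rewrite card_disjointU ?card_imset //.
rewrite -setI_eq0; apply/eqP/setP => v; rewrite !inE; apply/negP.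
move=> /andP[/imsetP[w]]; rewrite inE => /andP[wB _] -> /andP[_].
by rewrite (negPf (new _ wB)).
Qed.

(** Induction on the triangles left to subdivide, with two invariants: no vertex is tagged by a
    triangle of [l], and every old triangle still in the complex is in [l]. *)
Lemma exists_subdivision (l : seq {set U}) (K : {set {set V}}) :
  uniq l -> (forall s, s \in l -> #|s| = 3%N) -> simplicial_complex K ->
  (forall (s : {set U}) w, s \in l -> inr (s, w) \notin vertices K) ->
  (forall s : {set U}, #|s| = 3%N -> old s \in K -> s \in l) ->
  exists Ks : nat -> {set {set V}}, [/\ Ks 0%N = K,
    forall i, (i < size l)%N ->
      tchebyshev_step L B (Ks i) (nth set0 (map old l) i) (Ks i.+1)
    & \sum_(r in Ks (size l)) t ^+ #|r| = \sum_(r in K) weight r].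
Proof.
elim: l K => [|s l IH] K /=.
  move=> _ _ KC _ no3; exists (fun=> K); split=> //; apply: eq_bigr => r rK.
  (* With no triangle left, a face has at most two old vertices, and there [P] is a power of [t]. *)
  rewrite /weight P_small -?exprD ?cardsID // ltnNge; apply/negP => r3.
  have : (0 < #|[set A : {set V} | A \subset r :&: O & #|A| == 3%N]|)%N.
    by rewrite cards_draws bin_gt0.
  rewrite card_gt0 => /set0Pn[A]; rewrite inE subsetI -andbA => /and3P[Ar AO /eqP A3].
  have [s sE] := old_preim AO.
  by have := no3 s; rewrite -card_old -sE A3 (KC.2 _ _ rK Ar) => /(_ erefl isT).
move=> /andP[sl ul] l3 KC fresh all3.
have s3 : #|s| = 3%N by apply: l3; rewrite mem_head.
have [psi [pinj pB pnew]] := exists_new_vertices s3.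
have pinj' : {in vertices L &, injective psi} by move=> ? ? _ _; exact: pinj.
have freshs w : inr (s, w) \notin vertices K by apply: fresh; rewrite mem_head.
have pK w : w \in vertices L -> w \notin B -> psi w \notin vertices K.
  by move=> _ /pnew ->.
have [|||||Ks [K0 Kstep Ksum]] := IH (replace_face L K (old s) psi) => //.
- by move=> s' s'l; apply: l3; rewrite inE s'l orbT.
- exact: replace_face_complex.
- move=> s' w s'l; apply/negP => /(replace_face_vertices LC KC)[vK|[w' _]].
    by have := fresh s' w; rewrite inE s'l orbT vK => /(_ isT).
  case: (boolP (w' \in B)) => w'B.
    have : psi w' \in old s by rewrite -pB imset_f.
    by move=> /imsetP[u _ ->].
  by rewrite pnew // => -[ss' _]; move: sl; rewrite -ss' s'l.
(* An old triangle of the new complex was already in [K]; it is not [s], which could only come back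
   through [B] being a face of [L]. *)
- move=> s' s'3 /(in_replace_face _ _ _ KC)[[s'K ss']|[f [g [fL gl s'E]]]].
    have := all3 _ s'3 s'K; rewrite inE => /orP[/eqP e|//].
    by move: ss'; rewrite e subxx.
  have fB : f \subset B.
    apply/subsetP => w wf; apply: contraT => wB.
    have : psi w \in old s' by rewrite s'E inE imset_f.
    by rewrite pnew // => /imsetP[].
  move: gl; rewrite inE => /and3P[gK dsg sgK].
  have s'K : old s' \in K by apply: KC.2 sgK _; rewrite s'E -pB setSU // imsetS.
  have := all3 _ s'3 s'K; rewrite inE => /orP[/eqP e|//].
  case/negP: BL; suff <- : f = B by [].
  apply/eqP; rewrite eqEsubset fB; apply/subsetP => w wB.
  have ws : psi w \in old s by rewrite -pB imset_f.
  have : psi w \in old s' by rewrite e.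
  rewrite s'E inE (disjointFr dsg ws) orbF => /imsetP[w' w'f /pinj -> //].
exists (fun i => if i is i'.+1 then Ks i' else K); split=> //.
  case=> [_|i]; last exact: Kstep.
  by rewrite K0; exists psi; split.
rewrite Ksum (sum_replace_face LC KC pinj' pB BV pK); apply: eq_bigr => r rK; case: ifP => // sr.
exact: (@sum_weight_star K).
Qed.

Lemma exists_simplex_subdivision : exists (S : {set V}) (K' : {set {set V}}),
  [/\ #|S| = #|U|, simplicial_complex (powerset S),
      gen_tchebyshev_triangulation L B (powerset S) K'
    & \sum_(r in K') t ^+ #|r| = \sum_(r in powerset S) P #|r|].
Proof.
have OC : simplicial_complex (powerset O).
  split=> [|s s']; rewrite !powersetE ?sub0set // => sO s's.
  exact: subset_trans s's sO.
pose l := enum [set s : {set U} | #|s| == 3%N].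
have lP s : (s \in l) = (#|s| == 3%N) by rewrite mem_enum inE.
have [|||||Ks [K0 Kstep Ksum]] := @exists_subdivision l (powerset O).
- exact: enum_uniq.
- by move=> s; rewrite lP => /eqP.
- exact: OC.
- move=> s w _; rewrite inE powersetE sub1set; by apply/imsetP => -[].
- by move=> s s3 _; rewrite lP s3.
exists O, (Ks (size l)); split=> //.
- by rewrite card_old cardsT.
- exists (map old l), Ks; rewrite size_map; split=> //.
    by rewrite map_inj_uniq ?enum_uniq.
  move=> s; rewrite powersetE; apply/mapP/andP => [[s' + ->]|[/old_preim[s' ->] s3]].
    by rewrite lP card_old old_sub.
  by exists s' => //; rewrite lP -card_old.
rewrite Ksum; apply: eq_bigr => r; rewrite powersetE => rO.
rewrite /weight (setIidPl rO); move: rO; rewrite -setD_eq0 => /eqP ->.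
by rewrite cards0 mulr1.
Qed.

End Subdivide.

(** * The recurrence and its roots *)

Lemma triangulation_class_counts (R : realType) (W : finType)
    (L : {set {set W}}) (B : {set W}) :
  triangle_triangulation R L B -> B \notin L ->
  [/\ forall s, s \in L -> (#|s| <= 3)%N, nclass L B 2 1 = 3%N,
      (nclass L B 1 2 + 3 = nclass L B 1 1)%N,
      (nclass L B 0 3 + nclass L B 1 1 = 2 * nclass L B 0 1 + 1)%N
    & (nclass L B 0 2 + nclass L B 1 1 = 3 * nclass L B 0 1)%N].
Proof.
move=> [LC [p LG]] BL.
have [[B3 BV _] _ Lcap _ _] := LG.
have vL v : v \in vertices L -> [set v] \in L by rewrite inE.
(* Two distinct vertices at one point would put that point in the hull of the empty set, which is
   empty. *)
have pinj : {in vertices L &, injective p}.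
  move=> u v /vL uL /vL vL' puv; apply: contrapT => /eqP uv.
  have hullv w : hull p [set w] (p w).
    by exists (fun=> 1); split; rewrite ?big_set1 ?scale1r.
  have := Lcap _ _ uL vL'; move/(congr1 (fun X => X (p u))) => /= e.
  have : hull p ([set u] :&: [set v]) (p u).
    by rewrite -e; split=> //; rewrite puv.
  rewrite disjoint_setI0 ?disjoints1 ?inE // => -[a [_ + _]].
  by rewrite big_set0 => /esym/eqP; rewrite oner_eq0.
have [k hinj] := exists_generic_direction pinj.
have [mu muP] : exists mu : {set W} -> W -> R, forall A, nondegenerate_triangle p L A ->
    direction_weights p A (direction k) (mu A).
  have ex A : exists m, nondegenerate_triangle p L A ->
      direction_weights p A (direction k) m.
    case: (pselect (nondegenerate_triangle p L A)) => [|nA]; last by exists (fun=> 0).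
    case=> AV A3 iA; have [|m mP] := @exists_direction_weights _ _ p A k _ A3 iA.
      by move=> u v /(subsetP AV) uV /(subsetP AV); exact: hinj.
    by exists m.
  by have [mu muP] := choice ex; exists mu.
have cf := face_card LC LG hinj.
have edge_in (e : {set W}) : e \subset B -> #|e| = 2%N -> e \in L.
  by move=> eB e2; exact: (boundary_edge LC LG hinj muP eB e2).
have edge_deg (e : {set W}) : e \in L -> #|e| = 2%N ->
    (\sum_(t in triangles L) (e \subset t) = 2 - (e \subset B))%N.
  by move=> eL e2; exact: (edge_degree LC LG hinj muP eL e2).
have tri := card_triangles LC LG hinj muP.
by have [] := class_counts LC B3 BL edge_in edge_deg tri.
Qed.

(** Any vertex lies in the hull of [B]; if [B] is a face, a vertex outside [B] would again give a
    point in the hull of the empty set. *)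
Lemma triangulation_containing_frame (R : realType) (W : finType)
    (L : {set {set W}}) (B : {set W}) :
  triangle_triangulation R L B -> B \in L -> vertices L = B.
Proof.
move=> [LC [p LG]] BL; have [[B3 BV _] _ Lcap Lcov _] := LG.
apply/eqP; rewrite eqEsubset BV andbT; apply/subsetP => v; rewrite inE => vL.
apply: contraT => vB; have := Lcap _ _ vL BL.
have hv : hull p [set v] (p v).
  by exists (fun=> 1); split; rewrite ?big_set1 ?scale1r.
move/(congr1 (fun X => X (p v))) => /= e.
have : hull p ([set v] :&: B) (p v).
  by rewrite -e; split; [exact: hv|exact: (hull_face_sub LG vL hv)].
rewrite disjoint_setI0 ?disjoints1 // => -[a [_ + _]].
by rewrite big_set0 => /esym/eqP; rewrite oner_eq0.
Qed.

Lemma exists_cubic_recurrence (X : Type) (F : X -> X -> X -> X) (a b c : X) :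
  exists P : nat -> X, [/\ P 0%N = a, P 1%N = b, P 2%N = c
    & forall k, P k.+3 = F (P k) (P k.+1) (P k.+2)].
Proof.
pose st n := iter n (fun x => (x.1.2, x.2, F x.1.1 x.1.2 x.2)) (a, b, c).
by exists (fun n => (st n).1.1).
Qed.

(** The system is unitriangular: the top face contributes [f n] and the proper faces vanish by
    induction. It passes from sums over whole simplices to single powers of [t]. *)
Lemma simplex_sum_eq0 (M : zmodType) (f : nat -> M) :
  (forall n, exists (V : finType) (O : {set V}),
     #|O| = n /\ \sum_(r in powerset O) f #|r| = 0) ->
  forall n, f n = 0.
Proof.
move=> H; elim/ltn_ind => n IH; have [V [O [On]]] := H n.
rewrite (bigD1 O) ?powersetE //= big1 ?addr0 ?On // => r /andP[].
rewrite powersetE => rO ne; apply: IH; rewrite -On; apply: proper_card.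
by rewrite properEneq ne.
Qed.

(** * Polynomials expanded in powers of [t = (x - 1) / 2] *)

Section HalfShift.
Variable R : realType.
Local Notation t := (half_shift R).

Lemma X_half_shift : 'X = 1 + t *+ 2.
Proof.
rewrite /half_shift -mulrnAl -polyCMn -[_^-1 *+ _]mulr_natr mulVf ?pnatr_eq0 //.
by rewrite mul1r addrC subrK.
Qed.

Lemma half_shift_span (q : {poly R}) : exists n (c : nat -> R),
  q = \sum_(i < n) c i *: t ^+ i.
Proof.
pose r := q \Po (1 + 'X *+ 2); exists (size r), (fun i => r`_i).
rewrite -comp_polyE /r -comp_polyA -[LHS]comp_polyXr; congr (_ \Po _).
by rewrite comp_polyD mulr2n comp_polyD comp_polyX -polyC1 comp_polyC -mulr2n X_half_shift.
Qed.

Lemma half_shift_linear_eq (T T' : {linear {poly R} -> {poly R}}) :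
  (forall n, T (t ^+ n) = T' (t ^+ n)) -> T =1 T'.
Proof.
move=> e q; have [n [c ->]] := half_shift_span q.
by rewrite !linear_sum; apply: eq_bigr => i _; rewrite !linearZ /= e.
Qed.
End HalfShift.

(** * The recurrence of [T] in powers of [t] and then of [x] *)

Section Recurrence.
Variables (R : realType) (W : finType) (L : {set {set W}}) (B : {set W}).
Variable T : {linear {poly R} -> {poly R}}.
Hypotheses (hL : triangle_triangulation R L B) (hT : is_tchebyshev_map L B T).
Local Notation t := (half_shift R).

(** Here [L] is the full simplex on [B], so each step gives back the same complex and the constant
    sequence [powerset O] is admissible. *)
Lemma trivial_subdivision : B \in L -> T =1 id.
Proof.
move=> BL; have [LC [p [[B3 BV _] _ _ _ _]]] := hL.
have VB := triangulation_containing_frame hL BL.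
suff e n : T (t ^+ n) = t ^+ n by apply: (@half_shift_linear_eq R T idfun).
apply/eqP; rewrite -subr_eq0; apply/eqP; move: n.
apply: (@simplex_sum_eq0 _ (fun n => T (t ^+ n) - t ^+ n)) => n.
pose O : {set 'I_n} := [set: 'I_n].
have KC : simplicial_complex (powerset O).
  by split=> [|s s']; rewrite !powersetE !subsetT.
exists 'I_n, O; split; first by rewrite cardsT card_ord.
rewrite sumrB -linear_sum -FpolyE (hT KC (K' := powerset O)) ?subrr //.
exists (enum [set s : {set 'I_n} | #|s| == 3%N]), (fun=> powerset O).
split=> [|s| | |i ilt] //; first exact: enum_uniq.
  by rewrite mem_enum inE powersetE subsetT.
set s := nth _ _ _; have s3 : #|s| = 3%N.
  by apply/eqP; have := mem_nth set0 ilt; rewrite mem_enum inE.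
have [||f [finj fB]] := @exists_bijection_on W 'I_n B s; first by rewrite B3.
  by rewrite -card_gt0 s3.
exists f; rewrite VB; split=> // [w -> //|].
apply/setP => r; rewrite powersetE subsetT; apply/esym/(in_replace_face _ _ _ KC).
case: (boolP (s \subset r)) => sr; last by left; rewrite powersetE subsetT.
right; exists B, (r :\: s); rewrite fB; split=> //.
  rewrite linkE //; apply: imset_f; by rewrite inE powersetE subsetT.
by rewrite -{1}(setIidPr sr) setID.
Qed.

Local Notation N j k := (nclass L B j k).

(** The sequence [P] is defined by the desired recurrence; [T (t ^+ n)] and [P n] have the same sum
    over the faces of every simplex, hence agree. *)
Lemma tchebyshev_half_shift_recurrence : B \notin L ->
  [/\ T 1 = 1, T t = t, T (t ^+ 2) = t ^+ 2 & forall n, T (t ^+ n.+3) =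
    (t *+ N 0 1 + t ^+ 2 *+ N 0 2 + t ^+ 3 *+ N 0 3) * T (t ^+ n)
    + (t *+ N 1 1 + t ^+ 2 *+ N 1 2) * T (t ^+ n.+1)
    + t *+ N 2 1 * T (t ^+ n.+2)].
Proof.
move=> BL; have [LC [p [[B3 BV _] _ _ _ _]]] := hL.
have [card_face _ _ _ _] := triangulation_class_counts hL BL.
have [P [P0 P1 P2 PS]] := exists_cubic_recurrence (fun x0 x1 x2 =>
  (t *+ N 0 1 + t ^+ 2 *+ N 0 2 + t ^+ 3 *+ N 0 3) * x0
  + (t *+ N 1 1 + t ^+ 2 *+ N 1 2) * x1 + t *+ N 2 1 * x2) 1 t (t ^+ 2).
have P_small k : (k < 3)%N -> P k = t ^+ k.
  by case: k => [|[|[|k]]]; rewrite ?P0 ?P1 ?P2 ?expr0 ?expr1.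
have P_rec k : P k.+3 =
    \sum_(s in L | ~~ (s \proper B)) P (k + #|s :&: B|)%N * t ^+ #|s :\: B|.
  rewrite (sum_inner BL card_face (fun i j => P (k + i)%N * t ^+ j)) PS.
  rewrite !addn0 !addn1 addn2; ring.
suff TP n : T (t ^+ n) = P n.
  have := TP 0%N; have := TP 1%N; have := TP 2%N.
  rewrite P0 P1 P2 expr0 expr1 => ? ? ?.
  by split=> // n; rewrite !TP PS.
apply/eqP; rewrite -subr_eq0; apply/eqP; move: n.
apply: (@simplex_sum_eq0 _ (fun n => T (t ^+ n) - P n)) => n.
have [S [K' [Sn SC SK' sumE]]] :=
  @exists_simplex_subdivision W 'I_n L B LC B3 BV BL _ t P P_small P_rec.
exists ('I_n + {set 'I_n} * W)%type, S; split; first by rewrite Sn card_ord.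
by rewrite sumrB -linear_sum -FpolyE (hT SC SK') FpolyE sumE subrr.
Qed.

Lemma tchebyshev_recurrence : B \notin L ->
  exists m D : nat, [/\ (0 < D)%N, (D <= 2 * m + 1)%N, (1 <= 2 * m)%N,
    [/\ T 1 = 1, T 'X = 'X & T ('X ^+ 2) = 'X ^+ 2] & forall n,
    T ('X ^+ n.+3) = 'X * T ('X ^+ n.+2) *+ 3 - 'X ^+ 2 * T ('X ^+ n.+1) *+ 3
      + 'X ^+ 3 * T ('X ^+ n)
      + ('X ^+ 2 - 1) * (T ('X ^+ n.+1) - 'X * T ('X ^+ n)) *+ D
      + 'X * ('X ^+ 2 - 1) * T ('X ^+ n) *+ (2 * m)].
Proof.
move=> BL; have [_ n21 n12 n03 n02] := triangulation_class_counts hL BL.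
have [T0 T1 T2 TS] := tchebyshev_half_shift_recurrence BL.
have TDMn a b k : T (a + b *+ k) = T a + T b *+ k by rewrite linearD linearMn.
(* The bounds follow from [D = N 1 2 + 3] and [N 0 3 = 2 m + 1 - D]. *)
exists (N 0 1), (N 1 1); split; [lia|lia|lia| |].
  split=> //; rewrite X_half_shift; first by rewrite TDMn T0 T1.
  have -> : (1 + t *+ 2) ^+ 2 = 1 + t *+ 4 + t ^+ 2 *+ 4 by ring.
  by rewrite !TDMn T0 T1 T2.
move=> n; rewrite ![_ ^+ n.+3]exprS ![_ ^+ n.+2]exprS ![_ ^+ n.+1]exprS.
move: ('X ^+ n) => q.
(* Since ['X ^+ n] is not a power of [t], the recurrence is first extended by linearity to multiples
   of an arbitrary [q]. *)
have Tq : T (t ^+ 3 * q) =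
    (t *+ N 0 1 + t ^+ 2 *+ N 0 2 + t ^+ 3 *+ N 0 3) * T q
    + (t *+ N 1 1 + t ^+ 2 *+ N 1 2) * T (t * q)
    + t *+ N 2 1 * T (t ^+ 2 * q).
  have [d [c ->]] := half_shift_span q.
  rewrite !mulr_sumr !linear_sum /= !mulr_sumr -!big_split /=.
  apply: eq_bigr => i _; rewrite -!scalerAr !linearZ /=.
  by rewrite -!exprD -exprS add3n add2n TS -!scalerAr -!scalerDr.
have q1 : 'X * q = q + t * q *+ 2 by rewrite X_half_shift; ring.
have q2 : 'X * ('X * q) = q + t * q *+ 4 + t ^+ 2 * q *+ 4.
  by rewrite X_half_shift; ring.
have q3 : 'X * ('X * ('X * q))
    = q + t * q *+ 6 + t ^+ 2 * q *+ 12 + t ^+ 3 * q *+ 8.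
  by rewrite X_half_shift; ring.
rewrite q3 q2 q1 !TDMn Tq X_half_shift n21.
(* Multiples by counts become products with opaque ring elements, so that the relations among counts
   can be solved with subtraction before [ring]. *)
have [v vE vR] : exists2 v : nat -> {poly R},
    forall (x : {poly R}) k, x *+ k = x * v k & forall k, v k = k%:R.
  by exists (fun k => k%:R) => // x k; rewrite mulr_natr.
have c12 : v (N 1 2) = v (N 1 1) - 3%:R by rewrite !vR -n12 natrD addrK.
have c03 : v (N 0 3) = 2%:R * v (N 0 1) + 1 - v (N 1 1).
  by apply/eqP; rewrite eq_sym subr_eq !vR -natrM -natrD n03 natrD.
have c02 : v (N 0 2) = 3%:R * v (N 0 1) - v (N 1 1).
  by rewrite !vR -natrM -n02 natrD addrK.
rewrite !mulrnA !(vE _ (N _ _)) c12 c03 c02.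
move: (T q) (T (t * q)) (T (t ^+ 2 * q)) (v (N 0 1)) (v (N 1 1)) t.
move=> a0 a1 a2 m D x; ring.
Qed.
End Recurrence.

Theorem theorem6p3 (R : realType) (W : finType) (L : {set {set W}})
    (B : {set W}) (hL : triangle_triangulation R L B)
    (T : {linear {poly R} -> {poly R}}) (hT : is_tchebyshev_map L B T)
    (n : nat) :
  only_real_roots (T 'X^n).
Proof.
move=> z; case: (boolP (B \in L)) => BL.
  rewrite (trivial_subdivision hL hT BL) map_polyXn /root hornerXn expf_eq0.
  by move=> /andP[_ /eqP ->].
have [m [D [D0 Dm m1 [T0 T1 T2] TS]]] := tchebyshev_recurrence hL hT BL.
move=> rz; apply/eqP; apply: contraT => z_neq0.
pose ev (q : {poly R}) := (map_poly (real_complex R) q).[z].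
have evB q r : ev (q - r) = ev q - ev r by rewrite /ev rmorphB hornerD hornerN.
have evD q r : ev (q + r) = ev q + ev r by rewrite /ev rmorphD hornerD.
have evM q r : ev (q * r) = ev q * ev r by rewrite /ev rmorphM hornerM.
have evMn q k : ev (q *+ k) = ev q *+ k by rewrite /ev rmorphMn hornerMn.
have evX : ev 'X = z by rewrite /ev map_polyX hornerX.
have ev1 : ev 1 = 1 by rewrite /ev rmorph1 hornerC.
have evXn k : ev ('X ^+ k) = z ^+ k by rewrite /ev map_polyXn hornerXn.
(* [A], [b], [c] are the values of the functional on [y^k], [y^k v] and [y^k v^2], where
   [v = y - x]. *)
pose A k := T ('X ^+ k); pose b k := A k.+1 - 'X * A k.
pose c k := b k.+1 - 'X * b k.
have AS k : A k.+1 = 'X * A k + b k by rewrite /b addrC subrK.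
have bS k : b k.+1 = 'X * b k + c k by rewrite /c addrC subrK.
have cS k : c k.+1 = 'X * c k + ('X ^+ 2 - 1) * b k *+ D
    + 'X * ('X ^+ 2 - 1) * A k *+ (2 * m).
  by rewrite /c /b /A TS; ring.
have A0 : A 0%N = 1 by rewrite /A expr0 T0.
have b0 : b 0%N = 0 by rewrite /b /A expr0 expr1 T0 T1; ring.
have c0 : c 0%N = 0 by rewrite /c /b /A expr0 expr1 T0 T1 T2; ring.
have ev0 : ev 0 = 0 by rewrite /ev rmorph0 horner0.
suff /(_ n)/negP[] : forall k, ev (A k) != 0 by [].
move: AS bS cS A0 b0 c0; clearbody A b c ev => AS bS cS A0 b0 c0.
apply: (@homogeneous_cubic_recurrence_nonzero R m%:R D%:R z _
  (fun k => ev (b k)) (fun k => ev (c k))) => //.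
- by rewrite ler1n.
- by rewrite -natrM natr1 -addn1 ler_nat.
- by rewrite -natrM ler1n.
- by rewrite A0.
- by rewrite b0.
- by rewrite c0.
- by move=> k; rewrite AS evD evM evX.
- by move=> k; rewrite bS evD evM evX.
move=> k; rewrite cS !evD !evMn !evM !evB !evXn ev1 evX rmorph_nat.
by rewrite -[_ *+ D]mulr_natr -[_ *+ (2 * m)]mulr_natr natrM rmorphM /= !rmorph_nat; ring.
Qed.
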